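(* For every minimal symplectic $A_\infty$-algebra $A=(U,m,\omega)$ whose symplectic form is even and has order zero, the partition function $Z_A:\mathcal G_{\bullet\bullet}\to\mathbb C$ and the characteristic class $c_A$ are related by $$Z_A(\Gamma)=\langle\langle c_A,\Gamma\rangle\rangle\qquad\text{for all }\Gamma\in\mathcal G_{\bullet\bullet}.$$ That is, the composite of the characteristic class map $A\mapsto c_A$ with the map $x\mapsto\langle\langle x,-\rangle\rangle$ into $\mathrm{Hom}(\mathcal G_{\bullet\bullet},\mathbb C)$ equals the partition function map $A\mapsto Z_A$.
   Context: **Conventions.** All vector spaces are $\mathbb Z/2$-graded over $\mathbb C$ with the Koszul sign rule; $\Pi$ is parity reversion; underlying spaces of $A_\infty$-algebras are finite dimensional. $\sigma\in S_n$ acts on $V^{\otimes n}$ by moving the $i$-th factor to position $\sigma(i)$ (with Koszul signs). $z_n=(n\ n-1\ \ldots\ 1)$ generates $Z_n$; $N=1+z_n+\cdots+z_n^{n-1}$ on $V^{\otimes n}$. Subscripts denote coinvariants. **Formal noncommutative geometry.** $\widehat T(V)=\prod_{i\ge0}V^{\otimes i}$. Uncompleted forms: $\Omega^1(V)=T(V)\otimes T^+(V)$ ($x\otimes y$ meaning $x\,dy$) with bimodule structure $a\cdot(x\otimes y)=ax\otimes y$, $(x\otimes y)\cdot a=x\otimes ya-xy\otimes a$ (with $1\otimes\lambda=0$ for $\lambda\in\mathbb C$); $dx=1\otimes x$ for $x\in T^+(V)$, $d\lambda=0$ for $\lambda\in\mathbb C$; $\Omega^\bullet(V)=T_{T(V)}[\Pi\Omega^1(V)]$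 with induced $d$; $DR^\bullet(V)=\Omega^\bullet/[\Omega^\bullet,\Omega^\bullet]$; the order of $x_0dx_1\cdots dx_n$ is $\sum\mathrm{ord}(x_i)-n$. $\widehat{DR}^\bullet(V)$ is the $I$-adic completion, $\widehat{DR}^0(V)=\prod_i(V^{\otimes i})_{Z_i}$. A vector field is a continuous derivation $\xi$ of $\widehat T(V)$, with Lie derivative $L_\xi(x)=\xi(x)$, $L_\xi(dx)=(-1)^{|\xi|}d(\xi(x))$ and contraction $i_\xi(x)=0$, $i_\xi(dx)=\xi(x)$ (derivations of forms, descending to $\widehat{DR}$). A symplectic form is a closed 2-form $\omega$ with $\xi\mapsto i_\xi\omega$ bijective onto 1-forms. There is an isomorphism $\Theta:\prod_{i\ge1}V^{\otimes i}\to\widehat{DR}^1(V)$, $\Theta(x\otimes y)=dx\cdot y$ for $x\in V$. **Symplectic $A_\infty$-algebras.** $A=(U,m,\omega)$: a symplectic form $\omega\in\widehat{DR}^2(\Pi U^* )$ and an odd vector field $m$ on $\widehat T(\Pi U^* )$ with $L_m\omega=0$, $m^2=0$, $m$ vanishing at zero (no constant terms). Its Hamiltonian $h$ is the 0-form without constant and linear terms with $dh=i_m(\omega)$. Write $m=\sum_k m_k$ with $m_k(\Pi U^* )\subset(\Pi U^* )^{\otimes k}$, corresponding dually to maps $m_k:(\Pi U)^{\otimes k}\to\Pi U$; $A$ is minimal if $m_1=0$. **Inner products.** For $\omega$ of order zero, write $\omega=d\Theta(w)$ with $w\in(\Pi U^* )^{\otimes2}$; the tensor $(1-z_2)w$ depends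 only on $\omega$ and is the nondegenerate skew-symmetric bilinear form $\langle-,-\rangle$ on $\Pi U$ associated to $\omega$. Let $\langle-,-\rangle^{-1}$ be the form on $\Pi U^*$ such that $x\mapsto\langle x,-\rangle$, $\Pi U\to\Pi U^*$, followed by $y\mapsto\langle y,-\rangle^{-1}$, $\Pi U^*\to\Pi U^{**}$, is the canonical identification. (Signs are normalised so that if $\Pi U^*=\mathbb C^{2n|m}$ with $\omega=\sum dp_idq_i+\frac12\sum dx_idx_i$, then $\langle-,-\rangle^{-1}$ is the canonical form described below.) Let $h_k\in(\Pi U^* )^{\otimes k}$ be the cyclically invariant tensor $h_k(x_1,\ldots,x_k)=\langle m_{k-1}(x_1,\ldots,x_{k-1}),x_k\rangle$, with the sign conventions identifying multilinear functions with tensors such that $\sum_kh_k=\Theta^{-1}(i_m\omega)$. **Graphs.** A graph is a finite set of half-edges with a partition into vertices (each of cardinality, i.e. valency, $\ge3$) and a partition into two-element edges; the empty graph is allowed. A fully ordered graph also has a linear ordering of its vertices, an orientation of each edge, and a linear ordering of the half-edges at each vertex; it has type $(k_1,\ldots,k_r)$ if its $i$-th vertex has valency $k_i$. An orientation is a class of pairs (vertex ordering, edge orientations) under vertex permutations $\sigma$ and $s$ edge flips with $\mathrm{sgn}(\sigma)(-1)^s=1$ (two choices $\pm\sigma$); a ribbon structure is a cyclic ordering at each vertex. An oriented ribbon graph carries both, and is represented by fully ordered graphs. $\mathrm{Aut}(\Gamma)$ is the group of automorphisms preserving orientation and ribbon structure. $\mathcal G_{ij}$ is spanned by isomorphism classes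 of oriented ribbon graphs with $i$ vertices and $j$ edges, modulo $(\Gamma,-\sigma)=-(\Gamma,\sigma)$. A fully ordered graph $\tilde\Gamma$ with $k$ edges, with half-edges numbered $1,\ldots,2k$ in the order given by the vertex ordering and then the orderings at the vertices, gives an oriented chord diagram $c_{\tilde\Gamma}=(i_1,j_1),\ldots,(i_k,j_k)$ (its oriented edges). For such $c$, $\sigma_c\in S_{2k}$ sends $i_r\mapsto2r-1$, $j_r\mapsto2r$. **Partition function.** $Z_A$ is the linear map with, for $\tilde\Gamma$ of type $(k_1,\ldots,k_r)$ representing $\Gamma$, $$Z_A(\Gamma)=\frac{\kappa^A(\sigma_{c_{\tilde\Gamma}}\cdot(h_{k_1}\otimes\cdots\otimes h_{k_r}))}{|\mathrm{Aut}(\Gamma)|},\qquad\kappa^A(y_1\otimes\cdots\otimes y_{2k})=\langle y_1,y_2\rangle^{-1}\cdots\langle y_{2k-1},y_{2k}\rangle^{-1}.$$ **Characteristic class and pairing.** $V=\mathbb C^{2n|m}$ has even basis $p_i,q_i$, odd basis $x_i$, and even (graded) skew-symmetric form $\langle p_i,q_j\rangle=\langle x_i,x_j\rangle=\delta_{ij}$, $\langle x_i,p_j\rangle=\langle x_i,q_j\rangle=\langle p_i,p_j\rangle=\langle q_i,q_j\rangle=0$. $\mathfrak{osp}_{2n|m}$ is the Lie superalgebra annihilating it; $\tilde{\mathfrak g}_{2n|m}=\bigoplus_{i\ge3}(V^{\otimes i})_{Z_i}$; $C_\bullet(\mathfrak g_{2n|m},\mathfrak{osp}_{2n|m})=\Lambda_\bullet(\tilde{\mathfrak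 g}_{2n|m})_{\mathfrak{osp}_{2n|m}}$ where $\Lambda_\bullet(\mathfrak l)$ is $T(\mathfrak l)$ modulo $g\otimes h=-(-1)^{|g||h|}h\otimes g$; $C_{\bullet\bullet}(\mathfrak g,\mathfrak{osp})$ is the direct limit over $n,m$, bigraded by exterior power and half the total order, and completed to $\prod_{i,j}C_{ij}(\mathfrak g,\mathfrak{osp})$. For $A$ with $\Pi U^*$ of dimension $2n|m$, choose a linear symplectomorphism $\phi:\Pi U^*\to\mathbb C^{2n|m}$ taking $\omega$ to $\sum dp_idq_i+\frac12\sum dx_idx_i$, put $h'=\phi^*(h)$, and $c_A=\exp(h')=\sum_{i\ge0}\frac1{i!}h'\wedge\cdots\wedge h'$ (independent of $\phi$). For an oriented ribbon graph $\Gamma$ represented by $\tilde\Gamma$ of type $(k_1,\ldots,k_r)$, the map $\tilde F_{\tilde\Gamma}$ on $T(T^+(V))$ is $x\mapsto\kappa(\sigma_{c_{\tilde\Gamma}}\cdot x)$ on $V^{\otimes k_1}\otimes\cdots\otimes V^{\otimes k_r}$, where $\kappa(y_1\otimes\cdots\otimes y_{2k})=\langle y_1,y_2\rangle\cdots\langle y_{2k-1},y_{2k}\rangle$, and $0$ on all other summands. Set $$F_\Gamma(g_1\wedge\cdots\wedge g_l)=\tilde F_{\tilde\Gamma}\Big(\sum_{\sigma\in S_l}\mathrm{sgn}(\sigma)\,\sigma\cdot[(N\cdot g_1)\otimes\cdots\otimes(N\cdot g_l)]\Big),\qquad\langle\langle x,\Gamma\rangle\rangle=\frac{F_\Gamma(x)}{|\mathrm{Aut}(\Gamma)|},$$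 extended to completed chains (only finitely many bigraded components contribute for each $\Gamma$). *)

(* Defs.v *)
From HB Require Import structures.
From mathcomp Require Import all_boot all_order all_fingroup all_algebra.
From mathcomp Require Import reals.
From mathcomp Require Import complex.

Set Implicit Arguments.
Unset Strict Implicit.
Unset Printing Implicit Defensive.

Import GRing.Theory.
Local Open Scope ring_scope.

(* A finite dimensional super vector space is given by a homogeneous basis,   *)
(* i.e. a finite type L of letters with a parity par : L -> bool (true = odd).*)
(* A word s : seq L stands for the monomial s_1 (x) ... (x) s_n, and          *)
(* f : seq L -> F stands for the possibly infinite sum of the f s * s, i.e.   *)
(* for an element of the completed tensor algebra prod_i V^{(x) i}.           *)

Section Tensors.
Variable F : fieldType.

Definition wparity (L : Type) (par : L -> bool) (s : seq L) : bool :=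
  odd (count par s).

Definition word (L : eqType) (w : L) : L -> F := fun s => (s == w)%:R.

Inductive lin_span (X : Type) (G : (X -> F) -> Prop) : (X -> F) -> Prop :=
| Span0 f : f =1 (fun=> 0) -> lin_span G f
| SpanS c g f f' : G g -> lin_span G f ->
    f' =1 (fun x => c * g x + f x) -> lin_span G f'.

(* The action of sigma in S_n on V^{(x) n}, which moves the i-th factor to    *)
(* position sigma(i):                                                         *)
(*   sigma . (v_1 ... v_n) = ksign sigma v * (u_1 ... u_n), u_{sigma i} = v_i.*)
(* The letters may themselves be words (with parity wparity par), which       *)
(* gives the action of S_l on l-fold tensor powers of the tensor algebra.     *)
Definition ksign (L : Type) (par : L -> bool) n (sigma : 'I_n -> 'I_n)
    (v : n.-tuple L) : F :=
  \prod_(i < n) \prod_(j < n | ((i < j) && (sigma j < sigma i))%N)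
     (-1) ^+ (par (tnth v i) && par (tnth v j)).

Definition kact (L : Type) (par : L -> bool) n (sigma : 'I_n -> 'I_n)
    (f : seq L -> F) (u : n.-tuple L) : F :=
  let v := [tuple tnth u (sigma i) | i < n] in ksign par sigma v * f v.

(* z_n = (n n-1 ... 1) *)
Definition zcyc n : 'S_n := perm (@ord_pred_inj n).

Definition Nsym (L : Type) (par : L -> bool) (t : seq L -> F) (s : seq L) : F :=
  \sum_(i < size s) kact par (zcyc (size s) ^+ i)%g t (in_tuple s).

(* The algebra map of completed tensor algebras extending the even linear map *)
(* a |-> \sum_b M a b * b.                                                    *)
Definition push (L L' : finType) (M : L -> L' -> F) (f : seq L -> F)
    (s : seq L') : F :=
  \sum_(u : (size s).-tuple L)
     f u * \prod_(i < size s) M (tnth u i) (tnth (in_tuple s) i).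

(* The continuous derivation of the completed tensor algebra with value D a   *)
(* on the letter a.  The component of D a along the word s2 contributes       *)
(* parity par a + wparity s2 to the derivation, whence the sign of moving it  *)
(* past s1.                                                                   *)
Definition der (L : finType) (par : L -> bool) (D : L -> seq L -> F)
    (f : seq L -> F) (s : seq L) : F :=
  \sum_(i < (size s).+1) \sum_(j < (size s - i).+1) \sum_(a : L)
    let s1 := take i s in
    let s2 := take j (drop i s) in
    let s3 := drop (i + j) s in
    (-1) ^+ ((par a (+) wparity par s2) && wparity par s1)
      * f (s1 ++ a :: s3) * D a s2.

End Tensors.

(* Noncommutative differential forms on V = <I>.  Since Omega^1(V) is the     *)
(* free T(V)-bimodule on the dx_a (x (x) y is x dy), Omega^.(V) is the free   *)
(* algebra on the letters x_a = (a, false) and dx_a = (a, true).  The order   *)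
(* of a word is its number of letters x_a.                                    *)

Section Forms.
Variables (F : fieldType) (I : finType) (par : I -> bool).

Definition fpar (l : I * bool) : bool := par l.1 (+) l.2.

Definition form_degree (s : seq (I * bool)) : nat := count snd s.
Definition form_order (s : seq (I * bool)) : nat := count (predC snd) s.

Definition is_form (p : nat) (f : seq (I * bool) -> F) : Prop :=
  forall s, form_degree s != p -> f s = 0.

Definition gcommutator (u v : seq (I * bool)) (s : seq (I * bool)) : F :=
  word F (u ++ v) s
    - (-1) ^+ (wparity fpar u && wparity fpar v) * word F (v ++ u) s.

(* Equality in the completion of DR = Omega/[Omega, Omega]; the completion is *)
(* the product of the homogeneous components for the number of letters.       *)
Definition DReq (f g : seq (I * bool) -> F) : Prop :=
  forall k : nat,
    lin_span (fun c => exists u v, c = gcommutator u v)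
             (fun s => if size s == k then f s - g s else 0).

Definition form0 (f : seq I -> F) (s : seq (I * bool)) : F :=
  if form_degree s == 0%N then f (map fst s) else 0.

Definition dform : (seq (I * bool) -> F) -> seq (I * bool) -> F :=
  der fpar (fun l s => if l.2 then 0 else word F [:: (l.1, true)] s).

(* A vector field on V is given by its values xi a on the generators x_a.     *)
Definition vparity (p : bool) (xi : I -> seq I -> F) : Prop :=
  forall a s, xi a s != 0 -> wparity par s = par a (+) p.

Definition contraction (xi : I -> seq I -> F)
    : (seq (I * bool) -> F) -> seq (I * bool) -> F :=
  der fpar (fun l s => if l.2 then form0 (xi l.1) s else 0).

Definition Lie (p : bool) (xi : I -> seq I -> F)
    : (seq (I * bool) -> F) -> seq (I * bool) -> F :=
  der fpar (fun l s => if l.2 then (-1) ^+ p * dform (form0 (xi l.1)) s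
                       else form0 (xi l.1) s).

(* Theta (x (x) y) = dx . y *)
Definition Theta (t : seq I -> F) (s : seq (I * bool)) : F :=
  if s is (a, true) :: s' then
    if form_degree s' == 0%N then t (a :: map fst s') else 0
  else 0.

Definition symplectic_form (om : seq (I * bool) -> F) : Prop :=
  [/\ is_form 2 om, DReq (dform om) (fun=> 0),
      forall alpha, is_form 1 alpha ->
        exists xi, DReq (contraction xi om) alpha
    & forall xi xi', DReq (contraction xi om) (contraction xi' om) ->
        forall a, xi a =1 xi' a].

Definition even_form (om : seq (I * bool) -> F) : Prop :=
  DReq om (fun s => if wparity fpar s then 0 else om s).

Definition order_zero (om : seq (I * bool) -> F) : Prop :=
  DReq om (fun s => if form_order s == 0%N then om s else 0).

(* (1 - z_2) w, as the Gram matrix of a bilinear form on the dual space. *)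
Definition inner_product (w : seq I -> F) (a b : I) : F :=
  w [:: a; b] - kact par (zcyc 2) w [tuple a; b].

End Forms.

(* U has the homogeneous basis 'I_dimU with parity parU; the same index set   *)
(* is used for the dual basis of Pi U^*, whose parity is ainf_par.  The field *)
(* mvf is the odd vector field m, given on the generators.                    *)
Record sympAinf (F : fieldType) := SympAinf {
  dimU : nat;
  parU : 'I_dimU -> bool;
  ainf_par : 'I_dimU -> bool := fun a => ~~ parU a;
  omega : seq ('I_dimU * bool) -> F;
  mvf : 'I_dimU -> seq 'I_dimU -> F;
  omega_symplectic : symplectic_form ainf_par omega;
  mvf_odd : vparity ainf_par true mvf;
  mvf_omega : DReq ainf_par (Lie ainf_par true mvf omega) (fun=> 0);
  mvf_square : forall f, der ainf_par mvf (der ainf_par mvf f) =1 (fun=> 0);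
  mvf_zero : forall a, mvf a [::] = 0
}.

Section Ainf.
Variables (F : fieldType) (A : sympAinf F).
Local Notation I := 'I_(dimU A).
Local Notation par := (@ainf_par F A).

Definition minimal : Prop := forall a b : I, mvf a [:: b] = 0.

Definition hamiltonian (h : seq I -> F) : Prop :=
  [/\ h [::] = 0, forall a, h [:: a] = 0
    & DReq par (dform par (form0 h))
               (contraction par (@mvf F A) (@omega F A))].

(* w in V^{(x) 2} with omega = d Theta(w) in DR^2 *)
Definition order_zero_tensor (w : seq I -> F) : Prop :=
  (forall s, size s != 2%N -> w s = 0)
  /\ DReq par (@omega F A) (dform par (Theta w)).

Definition inverse_form (w : seq I -> F) (a b : I) : F :=
  invmx (\matrix_(i, j) inner_product par w i j) a b.

(* The sum over k of the tensors h_k = <m_{k-1}(x_1 ... x_{k-1}), x_k>, i.e.  *)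
(* m (x) id applied to the tensor \sum_(a, b) <a, b> x_a (x) x_b.  No sign    *)
(* occurs: for even omega and odd m one computes                              *)
(*   i_m omega = Theta (\sum_(a, b) <b, a> x_a (x) m(x_b)),                   *)
(* and z moves the factor x_a behind m(x_b), of the opposite parity, with     *)
(* sign +1.                                                                   *)
Definition htensor (w : seq I -> F) (s : seq I) : F :=
  if s is b0 :: s' then
    \sum_(a : I) inner_product par w a (last b0 s') * mvf a (belast b0 s')
  else 0.

End Ainf.

Record graph := Graph {
  hedge : finType;
  verts : {set {set hedge}};
  edges : {set {set hedge}};
  verts_partition : partition verts [set: hedge];
  edges_partition : partition edges [set: hedge];
  verts_valency : {in verts, forall v : {set hedge}, (3 <= #|v|)%N};
  edges_card : {in edges, forall e : {set hedge}, #|e| = 2%N}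
}.

Section Graphs.
Variable G : graph.
Local Notation H := (hedge G).

(* a vertex ordering and an orientation (i, j) of each edge {i, j} *)
Definition vertex_edge_order : finType :=
  ((#|verts G|.-tuple {set H}) * {set H * H})%type.

Definition valid_order (o : vertex_edge_order) : bool :=
  [&& [set v in o.1] == verts G,
      [forall p in o.2, [set p.1; p.2] \in edges G]
    & [forall e in edges G,
         #|[set p in o.2 | [set p.1; p.2] == e]| == 1%N]].

Definition same_orientation (o o' : vertex_edge_order) : bool :=
  [exists sigma : 'S_#|verts G|,
     (o'.1 == [tuple tnth o.1 (sigma i) | i < #|verts G|])
     && (odd_perm sigma == odd #|o'.2 :\: o.2|)].

(* A cyclic ordering of the half-edges at each vertex is a permutation whose  *)
(* cycles are the vertices.                                                   *)
Record oriented_ribbon := OrientedRibbon {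
  ribbon : {perm H};
  orientation : {set vertex_edge_order};
  ribbon_cycles : porbits ribbon = verts G;
  orientation_class : exists2 o, valid_order o &
    orientation = [set o' | valid_order o' && same_orientation o o']
}.

Definition move_order (f : {perm H}) (o : vertex_edge_order)
    : vertex_edge_order :=
  ([tuple f @: tnth o.1 i | i < #|verts G|], [set (f p.1, f p.2) | p in o.2]).

Definition Aut_ribbon (Ga : oriented_ribbon) : {set {perm H}} :=
  [set f : {perm H} |
    [&& [set f @: v | v : {set H} in verts G] == verts G,
        [set f @: e | e : {set H} in edges G] == edges G,
        [forall x, f (ribbon Ga x) == ribbon Ga (f x)]
      & [forall o in orientation Ga, move_order f o \in orientation Ga]]].

Record full_order := FullOrder {
  fo_order : vertex_edge_order;
  fo_hedges : {set H} -> seq H;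
  fo_valid : valid_order fo_order;
  fo_uniq : {in verts G, forall v, uniq (fo_hedges v)};
  fo_mem : {in verts G, forall v : {set H}, fo_hedges v =i v}
}.

Definition represents (Gt : full_order) (Ga : oriented_ribbon) : Prop :=
  fo_order Gt \in orientation Ga
  /\ {in verts G, forall v : {set H},
       {in v, forall x, ribbon Ga x = next (fo_hedges Gt v) x}}.

Section FullyOrdered.
Variable Gt : full_order.

Definition fo_lists : seq (seq H) := map (fo_hedges Gt) (fo_order Gt).1.
Definition fo_type : seq nat := map size fo_lists.

(* The position (from 0) of a half-edge; the default enum_rank h is not used, *)
(* as every half-edge occurs exactly once in fo_lists.                        *)
Definition hnumber (h : H) : 'I_#|H| :=
  insubd (enum_rank h) (index h (flatten fo_lists)).

Definition chord_diagram : seq ('I_#|H| * 'I_#|H|) :=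
  [seq (hnumber p.1, hnumber p.2) | p <- enum (fo_order Gt).2].

(* sigma_c sends i_r to 2r and j_r to 2r + 1, numbering from 0; the default i *)
(* is not used.                                                               *)
Definition sigma_chord (i : 'I_#|H|) : 'I_#|H| :=
  insubd i (index i (flatten [seq [:: c.1; c.2] | c <- chord_diagram])).

End FullyOrdered.

Section Contraction.
Variables (F : fieldType) (L : finType) (par : L -> bool) (B : L -> L -> F).

Fixpoint pairing_word (s : seq L) : F :=
  if s is a :: b :: s' then B a b * pairing_word s' else 1.

(* kappa (sigma_c . x_ty), where x lies in the completed T(T(V)), with basis  *)
(* the lists of words, and x_ty is its component in                           *)
(* V^{(x) k_1} (x) ... (x) V^{(x) k_r} for ty = (k_1, ..., k_r).              *)
Definition contract (Gt : full_order) (x : seq (seq L) -> F) : F :=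
  \sum_(u : #|H|.-tuple L)
    pairing_word u
      * kact par (sigma_chord Gt) (fun v => x (reshape (fo_type Gt) v)) u.

End Contraction.

End Graphs.

(* A spanning element of the graph complex, together with a fully ordered     *)
(* graph representing it.                                                     *)
Record ribbon_graph := RibbonGraph {
  rg_graph : graph;
  rg_oriented : oriented_ribbon rg_graph;
  rg_full : full_order rg_graph;
  rg_represents : represents rg_full rg_oriented
}.

(* Formal linear combinations of oriented ribbon graphs.  Every element of    *)
(* G_{..}, the quotient by isomorphisms and (Ga, -s) = -(Ga, s), has such a   *)
(* representative, on which linear maps out of G_{..} are evaluated.          *)
Definition graph_chain (F : fieldType) := seq (F * ribbon_graph).

Section PartitionFunction.
Variables (F : fieldType) (A : sympAinf F) (w : seq 'I_(dimU A) -> F).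

Definition Z_graph (Ga : ribbon_graph) : F :=
  contract (@ainf_par F A) (inverse_form w) (rg_full Ga)
    (fun ws => \prod_(s <- ws) htensor w s)
  / #|Aut_ribbon (rg_oriented Ga)|%:R.

Definition Z (ga : graph_chain F) : F := \sum_(t <- ga) t.1 * Z_graph t.2.

End PartitionFunction.

(* The basis of C^{2n|m}: p_i, q_i, x_i. *)
Definition letter (n m : nat) : finType := ('I_n + 'I_n + 'I_m)%type.
Definition p_ n m (i : 'I_n) : letter n m := inl (inl i).
Definition q_ n m (i : 'I_n) : letter n m := inl (inr i).
Definition x_ n m (i : 'I_m) : letter n m := inr i.

Definition lpar n m (a : letter n m) : bool := if a is inr _ then true else false.

Section Canonical.
Variable F : fieldType.

Definition canon_form n m (a b : letter n m) : F :=
  match a, b with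
  | inl (inl i), inl (inr j) => (i == j)%:R
  | inl (inr i), inl (inl j) => - (i == j)%:R
  | inr i, inr j => (i == j)%:R
  | _, _ => 0
  end.

Definition canon_omega n m (s : seq (letter n m * bool)) : F :=
  \sum_(i < n) word F [:: (p_ m i, true); (q_ m i, true)] s
  + 2%:R^-1 * \sum_(i < m) word F [:: (x_ n i, true); (x_ n i, true)] s.

(* osp_{2n|m}: xi a = \sum_b xi a b * b, homogeneous of parity p *)
Definition osp n m (p : bool) (xi : letter n m -> letter n m -> F) : Prop :=
  (forall a b, xi a b != 0 -> lpar b = lpar a (+) p)
  /\ forall a b,
      \sum_c xi a c * canon_form c b
        + (-1) ^+ (p && lpar a) * \sum_c xi b c * canon_form a c = 0.

Definition is_lin_symplectomorphism (A : sympAinf F) n m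
    (phi : 'I_(dimU A) -> letter n m -> F) : Prop :=
  [/\ forall a b, phi a b != 0 -> lpar b = ainf_par a,
      exists psi : letter n m -> 'I_(dimU A) -> F,
        (forall a a', \sum_b phi a b * psi b a' = (a == a')%:R)
        /\ (forall b b', \sum_a psi b a * phi a b' = (b == b')%:R)
    & DReq (@lpar n m)
        (push (fun k l => (k.2 == l.2)%:R * phi k.1 l.1) (@omega F A))
        (@canon_omega n m)].

(* Chains at level (n, m) are given by representatives x in T(T(V)),          *)
(* V = C^{2n|m}.                                                              *)

Inductive chain_relation n m : (seq (seq (letter n m)) -> F) -> Prop :=
(* cyclic coinvariants in each factor *)
| Rel_cyc us s vs : all (fun w => 2 < size w)%N (us ++ s :: vs) ->
    chain_relation (fun ws =>
      word F (us ++ s :: vs) ws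
      - (-1) ^+ (wparity (@lpar n m) (take 1 s) && wparity (@lpar n m) (drop 1 s))
        * word F (us ++ rot 1 s :: vs) ws)
(* g (x) h = - (-1)^(|g||h|) h (x) g *)
| Rel_alt us s t vs : all (fun w => 2 < size w)%N (us ++ s :: t :: vs) ->
    chain_relation (fun ws =>
      word F (us ++ s :: t :: vs) ws
      + (-1) ^+ (wparity (@lpar n m) s && wparity (@lpar n m) t)
        * word F (us ++ t :: s :: vs) ws)
(* osp coinvariants: xi . (s_1 (x) ... (x) s_l) *)
| Rel_osp p xi ss : all (fun w => 2 < size w)%N ss -> osp p xi ->
    chain_relation (fun ws =>
      (shape ws == shape ss)%:R
      * der (@lpar n m) (fun a s => if s is [:: b] then xi a b else 0)
          (word F (flatten ss)) (flatten ws)).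

(* the transition maps of the direct limit *)
Definition letter_incl n m n' m' (a : letter n m) (b : letter n' m') : F :=
  match a, b with
  | inl (inl i), inl (inl j) => (i == j :> nat)%:R
  | inl (inr i), inl (inr j) => (i == j :> nat)%:R
  | inr i, inr j => (i == j :> nat)%:R
  | _, _ => 0
  end.

Definition stabilize n m n' m' (x : seq (seq (letter n m)) -> F)
    (ws : seq (seq (letter n' m'))) : F :=
  push (@letter_incl n m n' m') (fun s => x (reshape (shape ws) s)) (flatten ws).

Record cell := Cell {
  cell_n : nat;
  cell_m : nat;
  cell_chain : seq (seq (letter cell_n cell_m)) -> F
}.

(* l-fold exterior powers of elements of order at least 3, of total order 2j *)
Definition in_bidegree (L : Type) (l j : nat) (ws : seq (seq L)) : bool :=
  [&& size ws == l, sumn (shape ws) == j.*2 & all (fun s => 2 < size s)%N ws].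

(* equality in C_{l j}(g, osp) = lim_{n, m} of the bidegree (l, j) components *)
Definition cell_eq (l j : nat) (c c' : cell) : Prop :=
  exists N M : nat,
    [/\ (maxn (cell_n c) (cell_n c') <= N)%N,
        (maxn (cell_m c) (cell_m c') <= M)%N
      & lin_span (@chain_relation N M)
          (fun ws => if in_bidegree l j ws
                     then stabilize (@cell_chain c) ws
                          - stabilize (@cell_chain c') ws
                     else 0)].

(* representatives of the elements of prod_{l, j} C_{l j}(g, osp) *)
Definition chain := nat -> nat -> cell.

Definition chain_eq (x y : chain) : Prop :=
  forall l j, cell_eq l j (x l j) (y l j).

(* exp(phi h); for minimal A the class of h has no components of order < 3 *)
Definition char_class (A : sympAinf F) n m
    (phi : 'I_(dimU A) -> letter n m -> F) (h : seq 'I_(dimU A) -> F) : chain :=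
  fun _ _ => Cell (fun ws =>
    if all (fun s => 2 < size s)%N ws
    then ((size ws)`!)%:R^-1 * \prod_(s <- ws) push phi h s
    else 0).

(* (N g_1) (x) ... (x) (N g_l) *)
Fixpoint Nsym_all (L : Type) (par : L -> bool) (x : seq (seq L) -> F)
    (ws : seq (seq L)) : F :=
  if ws is s :: ws' then
    Nsym_all par (fun vs => Nsym par (fun u => x (u :: vs)) s) ws'
  else x [::].

Definition antisym (L : Type) (par : L -> bool) (x : seq (seq L) -> F)
    (ws : seq (seq L)) : F :=
  \sum_(sigma : 'S_(size ws))
    (-1) ^+ sigma * kact (wparity par) sigma x (in_tuple ws).

Definition pairing_graph (x : chain) (Ga : ribbon_graph) : F :=
  let c := x #|verts (rg_graph Ga)| #|edges (rg_graph Ga)| in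
  contract (@lpar _ _) (@canon_form _ _) (rg_full Ga)
    (antisym (@lpar _ _) (Nsym_all (@lpar _ _) (@cell_chain c)))
  / #|Aut_ribbon (rg_oriented Ga)|%:R.

Definition pairing (x : chain) (ga : graph_chain F) : F :=
  \sum_(t <- ga) t.1 * pairing_graph x t.2.

End Canonical.

(* Main.v *)
Require Import Defs.
From mathcomp Require Import all_boot all_order all_fingroup all_algebra.
From mathcomp Require Import reals.
From mathcomp Require Import complex.
From mathcomp Require Import zify ring.

(* Both sides are sums over colorings of the half-edges by basis letters, in   *)
(* which the sign of an arrangement of the half-edges is its inversion parity, *)
(* weighted by the parities of the letters, relative to a fixed reference      *)
(* order.  All Koszul signs are then coboundaries, so permuting the vertices   *)
(* or rotating the half-edges at a vertex only replaces one arrangement by     *)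
(* another.                                                                    *)
(* In this form the pairing is insensitive to parity preserving linear maps    *)
(* carrying one form to the other and annihilates the relations defining the   *)
(* chain complex; the osp relations die because the sign of inserting an odd   *)
(* derivation at a half-edge does not depend on the arrangement.               *)
(* The cyclic symmetrization N kills commutators, hence is defined on DR, and  *)
(* evaluating it on dh = i_m(omega) gives N h = sum_k h_k.  Since the h_k are  *)
(* odd, antisymmetrization multiplies (N h') (x) ... (x) (N h') by r!, which   *)
(* cancels the 1/r! of exp(h').  Finally phi carries the inverse of the inner  *)
(* product of A to the canonical form.                                         *)

Set Implicit Arguments.
Unset Strict Implicit.
Unset Printing Implicit Defensive.

Import GRing.Theory.

(** * Koszul signs as inversion parities *)

(** The carrying facts, in mathematical order. By [ksign_block], the Koszul sign of moving one
    arrangement of the half-edges to another is the difference of two inversion parities. Hence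
    composites of moves (to the chords, among vertices, around a vertex) telescope:
    [contract_coloring] and [coloring_sum_expand] write F_Gamma(x) as a signed sum, over all
    arrangements of the half-edges, of one and the same expression [coloring_sum] in x. Naturality
    ([coloring_sum_push]) and osp invariance ([coloring_sum_letter_der]) are then proved for a
    single arrangement, and [graph_eval_cell_eq] concludes that F_Gamma depends only on the class of
    a chain.

    It remains to evaluate F_Gamma on exp(h'). Equalities in DR are only equalities modulo
    commutators, but N turns them into equalities of coefficients ([DReq_Nsym]). Applied to dh =
    i_m(omega) this gives [Nsym_hamiltonian]; applied to the normal form of omega it gives
    [inverse_formE], which identifies the inverse inner product with the pullback of the canonical
    form. With the count in [antisym_prod_odd], these are combined in [graph_eval_char_class]. *)

Ltac abstract_bools t :=
  lazymatch t with
  | ?a (+) ?b => abstract_bools a; abstract_bools b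
  | ?a && ?b => abstract_bools a; abstract_bools b
  | ~~ ?a => abstract_bools a
  | true => idtac
  | false => idtac
  | _ => generalize t
  end.

Ltac bool_taut :=
  rewrite /=; lazymatch goal with |- ?l = ?r => abstract_bools l; abstract_bools r end;
  repeat (intros [|]); reflexivity.

Section Pairs.
Variable T : Type.

Fixpoint pair_parity (g : T -> T -> bool) (s : seq T) : bool :=
  if s is x :: s' then \big[addb/false]_(y <- s') g x y (+) pair_parity g s'
  else false.

Definition cross_parity (g : T -> T -> bool) (s t : seq T) : bool :=
  \big[addb/false]_(x <- s) \big[addb/false]_(y <- t) g x y.

Lemma pair_parity_cat g s t :
  pair_parity g (s ++ t) =
    pair_parity g s (+) pair_parity g t (+) cross_parity g s t.
Proof.
elim: s => [|x s IH] /=; first by rewrite /cross_parity big_nil addbF.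
rewrite IH big_cat /= /cross_parity big_cons.
have AC a b c d e : (a (+) b) (+) (c (+) d (+) e) = (a (+) c) (+) d (+) (b (+) e).
  by move: a b c d e => [] [] [] [] [].
exact: AC.
Qed.

Lemma pair_parity_ord g n (u : n.-tuple T) :
  pair_parity g u =
  \big[addb/false]_(i < n) \big[addb/false]_(j < n | (i < j)%N)
     g (tnth u i) (tnth u j).
Proof.
elim: n u => [|n IH] u; first by rewrite (tuple0 u) big_ord0.
case/tupleP: u => x u /=; rewrite big_ord_recl IH; congr (_ (+) _).
  rewrite [RHS]big_mkcond big_ord_recl /= big_tuple.
  by apply: eq_bigr => j _; rewrite tnth0 tnthS.
apply: eq_bigr => i _; rewrite [RHS]big_mkcond big_ord_recl /=.
rewrite -big_mkcond /=; apply: eq_big => [j|j _]; last by rewrite !tnthS.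
by rewrite /bump /= !add1n ltnS.
Qed.

(** A pair whose order is kept by [sigma] contributes the same value to both parities and cancels;
    an inverted pair contributes [g] once in each order. *)
Lemma pair_parity_perm g n (sigma : 'I_n -> 'I_n) (u v : n.-tuple T) :
    injective sigma -> (forall i, tnth v i = tnth u (sigma i)) ->
  pair_parity g v (+) pair_parity g u =
  \big[addb/false]_(i < n) \big[addb/false]_(j < n | (i < j) && (sigma j < sigma i))
     (g (tnth v i) (tnth v j) (+) g (tnth v j) (tnth v i)).
Proof.
move=> sI uv; rewrite !pair_parity_ord.
have -> : \big[addb/false]_(i < n) \big[addb/false]_(j < n | i < j) g (tnth u i) (tnth u j)
  = \big[addb/false]_(i < n) \big[addb/false]_(j < n | sigma i < sigma j) g (tnth v i) (tnth v j).
  rewrite (reindex_inj sI); apply: eq_bigr => i _.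
  by rewrite (reindex_inj sI); apply: eq_bigr => j _; rewrite !uv.
have -> : \big[addb/false]_(i < n)
     \big[addb/false]_(j < n | (i < j) && (sigma j < sigma i))
        (g (tnth v i) (tnth v j) (+) g (tnth v j) (tnth v i)) =
   \big[addb/false]_(i < n)
     \big[addb/false]_(j < n | (i < j) && (sigma j < sigma i)) g (tnth v i) (tnth v j)
   (+) \big[addb/false]_(i < n)
     \big[addb/false]_(j < n | (j < i) && (sigma i < sigma j)) g (tnth v i) (tnth v j).
  rewrite [X in _ = _ (+) X](exchange_big_dep predT) //= -big_split /=.
  by apply: eq_bigr => i _; rewrite -big_split.
rewrite -!big_split; apply: eq_bigr => i _ /=.
rewrite [X in X (+) _]big_mkcond [X in _ (+) X]big_mkcond.
rewrite [X in _ = X (+) _]big_mkcond [X in _ = _ (+) X]big_mkcond -!big_split.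
apply: eq_bigr => j _ /=; set b := g _ _.
have [ij|] := eqVneq i j; first by rewrite ij !ltnn.
move=> ij; have sij : sigma i != sigma j by rewrite (inj_eq sI).
move: ij sij; rewrite -!val_eqE /= !neq_ltn.
by case: (ltngtP i j); case: (ltngtP (sigma i) (sigma j)); case: b.
Qed.

End Pairs.

Section InversionParity.
Variables (K : finType) (q : K -> bool).
Implicit Types (s t l : seq K) (ll : seq (seq K)).

Definition odd_inv (x y : K) : bool :=
  [&& (enum_rank y < enum_rank x)%N, q x & q y].

(* The Koszul sign of rearranging s into the order of enum K. *)
Definition inv_parity (s : seq K) : bool := pair_parity odd_inv s.

Lemma wparity_big s : wparity q s = \big[addb/false]_(x <- s) q x.
Proof.
elim: s => [|x s IH]; first by rewrite big_nil.
by rewrite big_cons -IH /wparity /= oddD; case: (q x).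
Qed.

(** Two distinct elements are out of order in exactly one of the two concatenations, so each pair of
    odd elements is counted once. Uniqueness excludes equal elements, which would be counted in
    neither. *)
Lemma cross_parityC s t : uniq (s ++ t) ->
  cross_parity odd_inv s t (+) cross_parity odd_inv t s
    = wparity q s && wparity q t.
Proof.
rewrite cat_uniq => /and3P[_ /hasPn st _].
rewrite /cross_parity (exchange_big_dep predT) //= -big_split /=.
rewrite (wparity_big t) big_distrr /=.
rewrite !big_seq; apply: eq_bigr => y yt.
rewrite -big_split (wparity_big s) big_distrl /=.
rewrite !big_seq; apply: eq_bigr => x xs; rewrite /odd_inv.
have : enum_rank x != enum_rank y.
  by rewrite (inj_eq enum_rank_inj); apply: contraNneq (st _ yt) => <-.
rewrite -val_eqE /= neq_ltn.
by case: (ltngtP (enum_rank x) (enum_rank y)); case: (q x); case: (q y).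
Qed.

Lemma inv_parity_cat s t :
  inv_parity (s ++ t) =
    inv_parity s (+) inv_parity t (+) cross_parity odd_inv s t.
Proof. exact: pair_parity_cat. Qed.

Lemma cross_parity_flatten l ll :
  cross_parity odd_inv l (flatten ll)
   = \big[addb/false]_(t <- ll) cross_parity odd_inv l t.
Proof.
elim: ll => [|t ll IH] /=; rewrite ?big_nil ?big_cons.
  by rewrite /cross_parity big1 // => x _; rewrite big_nil.
by rewrite -IH /cross_parity -big_split; apply: eq_bigr => x _; rewrite big_cat.
Qed.

Lemma inv_parity_flatten ll :
  inv_parity (flatten ll) =
    \big[addb/false]_(l <- ll) inv_parity l (+) pair_parity (cross_parity odd_inv) ll.
Proof.
elim: ll => [|l ll IH] /=; first by rewrite big_nil.
rewrite inv_parity_cat IH big_cons cross_parity_flatten.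
bool_taut.
Qed.

Lemma inv_parity_rot i s : uniq s ->
  inv_parity (rot i s) = inv_parity s (+) (wparity q (take i s) && wparity q (drop i s)).
Proof.
move=> us; rewrite /rot -{3}(cat_take_drop i s) !inv_parity_cat.
rewrite -(@cross_parityC (take i s) (drop i s)) ?cat_take_drop //.
bool_taut.
Qed.

Lemma cross_parity_perm s s' t t' : perm_eq s s' -> perm_eq t t' ->
  cross_parity odd_inv s t = cross_parity odd_inv s' t'.
Proof.
move=> ss' tt'; rewrite /cross_parity (perm_big _ ss') /=.
by apply: eq_bigr => x _; rewrite (perm_big _ tt').
Qed.

Lemma inv_parity_catr s t t' : perm_eq t t' ->
  inv_parity (s ++ t) (+) inv_parity (s ++ t') = inv_parity t (+) inv_parity t'.
Proof.
move=> tt'; rewrite !inv_parity_cat (cross_parity_perm (perm_refl s) tt').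
bool_taut.
Qed.

Lemma inv_parity_catl s s' t : perm_eq s s' ->
  inv_parity (s ++ t) (+) inv_parity (s' ++ t) = inv_parity s (+) inv_parity s'.
Proof.
move=> ss'; rewrite !inv_parity_cat (cross_parity_perm ss' (perm_refl t)).
bool_taut.
Qed.

Lemma wparity_perm s t : perm_eq s t -> wparity q s = wparity q t.
Proof. by move=> /seq.permP st; rewrite /wparity st. Qed.

End InversionParity.

Lemma eq_inv_parity (K : finType) (q q' : K -> bool) s :
  {in s, q =1 q'} -> inv_parity q s = inv_parity q' s.
Proof.
rewrite /inv_parity; elim: s => //= x s IH qq'; rewrite IH => [|y ys]; last first.
  by apply: qq'; rewrite inE ys orbT.
congr (_ (+) _); rewrite !big_seq; apply: eq_bigr => y ys.
by rewrite /odd_inv !qq' ?mem_head // inE ys orbT.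
Qed.

Lemma uniq_flatten_nth (K : eqType) (ll : seq (seq K)) i j :
    uniq (flatten ll) -> i < j -> j < size ll ->
  uniq (nth [::] ll i ++ nth [::] ll j).
Proof.
elim: ll i j => [|l ll IH] [|i] [|j] //=; rewrite ?ltnS cat_uniq => /and3P[ul d ull].
  move=> _ jl; have sub x : x \in nth [::] ll j -> x \in flatten ll.
    by move=> xj; apply/flattenP; exists (nth [::] ll j); rewrite ?mem_nth.
  rewrite cat_uniq ul /=; apply/andP; split.
    by apply: contra d => /hasP[x /sub xf xl]; apply/hasP; exists x.
  elim: ll j jl ull {IH d sub} => [|t ll IHl] [|j] //= jl; rewrite cat_uniq.
    by case/and3P.
  by case/and3P=> _ _; apply: IHl.
exact: IH.
Qed.

Section KoszulSign.
Variable F : fieldType.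
Local Open Scope ring_scope.

Lemma sign_big (T : Type) (r : seq T) (P : pred T) (b : T -> bool) :
  \prod_(i <- r | P i) (-1) ^+ b i = (-1) ^+ (\big[addb/false]_(i <- r | P i) b i) :> F.
Proof.
have sD : {morph (fun c : bool => (-1) ^+ c : F) : x y / x (+) y >-> x * y}.
  exact: signr_addb.
by rewrite (big_morph _ sD (erefl _)).
Qed.

Lemma ksign_big (L : Type) (par : L -> bool) n (sigma : 'I_n -> 'I_n)
    (v : n.-tuple L) :
  ksign F par sigma v =
  (-1) ^+ (\big[addb/false]_(i < n)
     \big[addb/false]_(j < n | ((i < j) && (sigma j < sigma i))%N)
       (par (tnth v i) && par (tnth v j))).
Proof. by rewrite -sign_big; apply: eq_bigr => i _; rewrite sign_big. Qed.

Lemma eq_ksign (L L' : Type) (par : L -> bool) (par' : L' -> bool) n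
    (sigma : 'I_n -> 'I_n) (v : n.-tuple L) (v' : n.-tuple L') :
    (forall i, par (tnth v i) = par' (tnth v' i)) ->
  ksign F par sigma v = ksign F par' sigma v'.
Proof.
by move=> E; apply: eq_bigr => i _; apply: eq_bigr => j _; rewrite !E.
Qed.

(** Koszul signs are coboundaries. Inside the blocks nothing changes, and for two exchanged blocks
    [cross_parityC] gives the product of their parities, which is the factor in [ksign]. *)
Lemma ksign_block (K : finType) (q : K -> bool) n (sigma : 'I_n -> 'I_n)
    (kk ll : n.-tuple (seq K)) :
    injective sigma -> (forall i, tnth ll i = tnth kk (sigma i)) ->
    uniq (flatten kk) ->
  ksign F (wparity q) sigma ll =
    (-1) ^+ (inv_parity q (flatten ll) (+) inv_parity q (flatten kk)).
Proof.
move=> sI lk uk; rewrite ksign_big !inv_parity_flatten; congr (_ ^+ nat_of_bool _).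
have <- : \big[addb/false]_(l <- ll) inv_parity q l = \big[addb/false]_(l <- kk) inv_parity q l.
  by rewrite !big_tuple [RHS](reindex_inj sI); apply: eq_bigr => i _; rewrite lk.
set a := (X in X (+) _ (+) (X (+) _)).
rewrite addbACA addbb addFb (pair_parity_perm _ sI lk).
apply: eq_bigr => i _; apply: eq_bigr => j /andP[ij sij].
rewrite cross_parityC // !lk uniq_catC.
by rewrite !(tnth_nth [::]); apply: uniq_flatten_nth; rewrite ?size_tuple.
Qed.

Lemma ksign_letter (K : finType) (q : K -> bool) n (sigma : 'I_n -> 'I_n)
    (u v : n.-tuple K) :
    injective sigma -> (forall i, tnth v i = tnth u (sigma i)) -> uniq u ->
  ksign F q sigma v = (-1) ^+ (inv_parity q v (+) inv_parity q u).
Proof.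
have fl (t : n.-tuple K) : flatten [tuple of [seq [:: x] | x <- t]] = t.
  by rewrite /=; elim: (tval t) => //= x s ->.
move=> sI vu uu; rewrite -(fl v) -(fl u) -(ksign_block _ sI) ?fl //.
  by apply: eq_ksign => i; rewrite tnth_map /wparity /= addn0 oddb.
by move=> i; rewrite !tnth_map vu.
Qed.

End KoszulSign.

(** * Cyclic symmetrization *)

Lemma nth_rot_mod (T : Type) (x0 : T) k (s : seq T) j : k <= size s -> j < size s ->
  nth x0 (rot k s) j = nth x0 s ((j + k) %% size s).
Proof.
rewrite /rot nth_cat size_drop => ks js.
case: ltnP => H; first by rewrite nth_drop modn_small addnC //; lia.
have -> : ((j + k) %% size s = j + k - size s)%N.
  by rewrite -{1}(@subnK (size s) (j + k)) ?modnDr ?modn_small //; lia.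
by rewrite nth_take; [congr nth|]; lia.
Qed.

Lemma val_zcyc n i (j : 'I_n) : i <= n ->
  ((zcyc n ^+ i)%g j = (j + (n - i)) %% n :> nat).
Proof.
elim: i => [|i IH] le_in; first by rewrite expg0 perm1 subn0 modnDr modn_small.
rewrite expgSr permM permE /= IH 1?ltnW //.
have -> : ((j + (n - i)) %% n + n).-1 = ((j + (n - i)) %% n + n.-1)%N by lia.
rewrite modnDml; have -> : (j + (n - i) + n.-1 = (j + (n - i.+1)) + n)%N by lia.
by rewrite modnDr.
Qed.

Lemma zcyc_tuple (T : Type) n (u : n.-tuple T) i : i <= n ->
  [tuple tnth u ((zcyc n ^+ i)%g j) | j < n] = rot (n - i) u :> seq T.
Proof.
case: n u => [|n] u le_in; first by rewrite [in LHS]tuple0 (tuple0 u).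
apply: (@eq_from_nth _ (thead u)); rewrite !size_tuple // => j js.
rewrite (nth_mktuple _ (thead u) (Ordinal js)) (tnth_nth (thead u)) val_zcyc //=.
by rewrite nth_rot_mod ?size_tuple ?leq_subr.
Qed.

Section CyclicSum.
Variables (F : fieldType) (L : Type) (par : L -> bool).
Local Open Scope ring_scope.
Implicit Types (s t : seq L) (f g : seq L -> F).

Definition rot_sign (i : nat) (s : seq L) : bool :=
  wparity par (take i s) && wparity par (drop i s).

Lemma wparity_map (K : Type) (h : K -> L) (s : seq K) :
  wparity par (map h s) = wparity (par \o h) s.
Proof. by rewrite /wparity count_map. Qed.

Lemma wparity_cat s t : wparity par (s ++ t) = wparity par s (+) wparity par t.
Proof. by rewrite /wparity count_cat oddD. Qed.

Lemma kact_zcyc s f i : (i <= size s)%N ->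
  kact par (zcyc (size s) ^+ i)%g f (in_tuple s) =
  (-1) ^+ rot_sign (size s - i) s * f (rot (size s - i) s) :> F.
Proof.
move=> le_is; rewrite /kact zcyc_tuple //=; congr (_ * _).
(* The letters of [s] may repeat, so the sign is computed on the positions, which are distinct, with
   [q] the parity of the letter at a position. *)
set n := size s; set q := fun j : 'I_n => par (tnth (in_tuple s) j).
pose u := ord_tuple n.
have us : map (tnth (in_tuple s)) u = s by rewrite map_tnth_enum.
have uu : uniq u by rewrite val_ord_tuple enum_uniq.
pose v := [tuple tnth u ((zcyc n ^+ i)%g j) | j < n].
have vE : v = rot (n - i) u :> seq 'I_n. by exact: zcyc_tuple.
rewrite (@eq_ksign _ _ _ _ q _ _ _ v) => [|j].
  rewrite (@ksign_letter _ _ q _ _ u) ?vE //; last 2 first.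
  - exact: perm_inj.
  - by move=> j; rewrite tnth_mktuple.
  rewrite inv_parity_rot // addbAC addbb addFb /rot_sign.
  by rewrite -{1 2}us -map_take -map_drop !wparity_map.
by rewrite /q !tnth_mktuple tnth_ord_tuple.
Qed.

(** The i-th power of z rotates by n - i; reversing the summation gives rotations by 1, ..., n, and
    rotation by n is rotation by 0, with sign 1. *)
Lemma Nsym_rot f s :
  Nsym par f s = \sum_(i < size s) (-1) ^+ rot_sign i s * f (rot i s) :> F.
Proof.
pose T i := (-1) ^+ rot_sign i s * f (rot i s) : F.
have T0 : T (size s) = T 0.
  by rewrite /T /rot_sign take_size drop_size rot_size take0 drop0 rot0 andbF.
rewrite /Nsym (eq_bigr (fun i : 'I_(size s) => T (size s - i)%N)) => [|i _].
  rewrite (reindex_inj rev_ord_inj) /=.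
  rewrite (eq_bigr (fun i : 'I_(size s) => T i.+1)) => [|i _]; last first.
    by congr T; have := ltn_ord i; lia.
  apply: (@addrI _ (T 0)).
  have := big_ord_recl (size s) (fun i => T i) : _ = (T 0 + _)%R.
  move <-; rewrite big_ord_recr /= addrC; congr (_ + _).
  by rewrite T0.
by rewrite kact_zcyc // ltnW.
Qed.

End CyclicSum.

Section CyclicInvariance.
Variables (F : fieldType) (L : eqType) (par : L -> bool).
Local Open Scope ring_scope.
Implicit Types (s t : seq L) (f g : seq L -> F).

Local Notation Nsym := (Nsym par).
Local Notation rot_sign := (rot_sign par).

Lemma eq_Nsym f g s :
  (forall i, (i < size s)%N -> f (rot i s) = g (rot i s)) -> Nsym f s = Nsym g s.
Proof.
by move=> fg; rewrite !Nsym_rot; apply: eq_bigr => i _; rewrite fg.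
Qed.

Lemma NsymD f g s : Nsym (fun u => f u + g u) s = Nsym f s + Nsym g s.
Proof.
by rewrite !Nsym_rot -big_split; apply: eq_bigr => i _; rewrite mulrDr.
Qed.

Lemma NsymZ c f s : Nsym (fun u => c * f u) s = c * Nsym f s.
Proof.
by rewrite !Nsym_rot big_distrr; apply: eq_bigr => i _; rewrite mulrCA.
Qed.

Lemma Nsym0 s : Nsym (fun=> 0) s = 0 :> F.
Proof. by rewrite Nsym_rot big1 // => i _; rewrite mulr0. Qed.

Lemma NsymB f g s : Nsym (fun u => f u - g u) s = Nsym f s - Nsym g s.
Proof.
rewrite NsymD -[- Nsym g s]mulN1r -NsymZ; congr (_ + _).
by apply: eq_Nsym => i _; rewrite mulN1r.
Qed.

Lemma Nsym_sum (J : Type) (r : seq J) (P : pred J) (h : J -> seq L -> F) s :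
  Nsym (fun u => \sum_(j <- r | P j) h j u) s = \sum_(j <- r | P j) Nsym (h j) s.
Proof.
rewrite Nsym_rot; under eq_bigr do rewrite big_distrr /=.
by rewrite exchange_big; apply: eq_bigr => j _; rewrite Nsym_rot.
Qed.

(** The cocycle identity for rotation signs, checked on s = abc with |a| = i and |b| = k. *)
Lemma rot_signD i k s : (i + k <= size s)%N ->
  rot_sign (i + k) s = rot_sign i s (+) rot_sign k (rot i s).
Proof.
move=> le_ik; rewrite /rot_sign.
pose a := take i s; pose b := take k (drop i s); pose c := drop (k + i) s.
have sE : s = a ++ b ++ c by rewrite /c -drop_drop !cat_take_drop.
have sa : size a = i by rewrite size_takel //; lia.
have sb : size b = k by rewrite size_takel // size_drop; lia.
have rE : rot i s = b ++ c ++ a.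
  by rewrite {1}sE -{1}sa rot_size_cat catA.
have -> : take (i + k) s = a ++ b.
  by rewrite sE catA take_size_cat // size_cat sa sb.
have -> : drop (i + k) s = c by rewrite addnC.
rewrite rE take_size_cat // drop_size_cat //.
have -> : drop i s = b ++ c by rewrite {1}sE drop_size_cat.
rewrite -[take i s]/a !wparity_cat.
bool_taut.
Qed.

Lemma Nsym_cyc K f s : (K <= size s)%N ->
  Nsym (fun u => (-1) ^+ rot_sign K u * f (rot K u)) s = Nsym f s.
Proof.
elim: K f => [|K IH] f le_Ks.
  by apply: eq_Nsym => i _; rewrite /rot_sign take0 rot0 /= mul1r.
transitivity (Nsym (fun u => (-1) ^+ rot_sign 1 u * f (rot 1 u)) s).
  rewrite -[RHS](IH _ (ltnW le_Ks)); apply: eq_Nsym => i _.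
  set u := rot i s; have su : (K < size u)%N by rewrite size_rot.
  by rewrite -(rotS su) mulrA -signr_addb -rot_signD ?addn1.
rewrite !Nsym_rot; pose T i := (-1) ^+ rot_sign i s * f (rot i s) : F.
have T0 : T (size s) = T 0.
  by rewrite /T /rot_sign take_size drop_size rot_size take0 drop0 rot0 andbF.
rewrite (eq_bigr (fun i : 'I_(size s) => T i.+1)) => [|i _]; last first.
  by rewrite /T mulrA -signr_addb -(rotS (ltn_ord i)) -rot_signD addn1.
apply: (@addrI _ (T 0)).
have := big_ord_recl (size s) (fun i => T i) : _ = (T 0 + _)%R.
by move <-; rewrite big_ord_recr /= addrC T0.
Qed.

(** The words uv and vu differ by a rotation with exactly the Koszul sign of the commutator, and N
    is invariant under signed rotations. This makes N well defined on the cyclic quotient. *)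
Lemma Nsym_commutator u v s :
  Nsym (fun x => word F (u ++ v) x
    - (-1) ^+ (wparity par u && wparity par v) * word F (v ++ u) x) s = 0.
Proof.
rewrite NsymB NsymZ.
have [sE|neq] := eqVneq (size s) (size u + size v)%N; last first.
  have N0 w : size w = (size u + size v)%N -> Nsym (word F w) s = 0.
    move=> sw; rewrite -[RHS](Nsym0 s); apply: eq_Nsym => i _; rewrite /word.
    by case: eqP => // E; case/negP: neq; rewrite -sw -E size_rot.
  by rewrite !N0 ?size_cat ?mulr0 ?subr0 // addnC.
have le_us : (size u <= size s)%N by rewrite sE leq_addr.
rewrite -(Nsym_cyc (word F (v ++ u)) le_us) -NsymZ -NsymB -[RHS](Nsym0 s).
apply: eq_Nsym => i _; set x := rot i s.
have -> : word F (v ++ u) (rot (size u) x) = word F (u ++ v) x.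
  by rewrite /word -rot_size_cat (inj_eq (@rot_inj _ _)).
rewrite /word; have [->|] := eqVneq x; last by rewrite !mulr0 subr0.
rewrite /rot_sign take_size_cat // drop_size_cat // mulrA -signr_addb addbb.
by rewrite mul1r subrr.
Qed.

Lemma Nsym_span (G : (seq L -> F) -> Prop) f s :
  (forall g, G g -> Nsym g s = 0) -> lin_span G f -> Nsym f s = 0.
Proof.
move=> G0; elim=> {f} [f f0|c g f f' Gg _ IH f'E].
  by rewrite -[RHS](Nsym0 s); apply: eq_Nsym.
rewrite (@eq_Nsym f' (fun x => c * g x + f x)) // NsymD NsymZ IH G0 //.
by rewrite mulr0 addr0.
Qed.

End CyclicInvariance.

(** * From classes in DR to coefficients of cyclic tensors *)

Section DeRham.
Variables (F : fieldType) (I : finType) (par : I -> bool).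
Local Open Scope ring_scope.

Lemma DReq_Nsym (f g : seq (I * bool) -> F) s :
  DReq par f g -> Nsym (fpar par) f s = Nsym (fpar par) g s.
Proof.
move=> /(_ (size s)) fg; apply/eqP; rewrite -subr_eq0 -NsymB.
rewrite (@eq_Nsym _ _ _ _ (fun u => if size u == size s then f u - g u else 0)).
  apply/eqP; apply: Nsym_span fg => _ [u [v ->]].
  exact: Nsym_commutator.
by move=> i _; rewrite size_rot eqxx.
Qed.

End DeRham.

(** * Derivations *)

Section EvenDerivation.
Variables (F : fieldType) (L : finType) (par : L -> bool).
Variable D : L -> seq L -> F.
Local Open Scope ring_scope.
(** The case needed is contraction with an odd field: x_a and dx_a have opposite parities, so it is
    an even derivation and passes letters without sign. *)
Hypothesis D_even : forall a s, D a s != 0 -> wparity par s = par a.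

(** The term of the derivation in which the arc of length [j] starting at position [k] of [u] comes
    from the letter [a]. *)
Let ins k j a (f : seq L -> F) (u : seq L) : F :=
  f (take k u ++ a :: drop (k + j) u) * D a (take j (drop k u)).

(** The same kind of term with the arc placed at the start of [u]; the position [k] now says where
    the cyclic word with the arc contracted to [a] is cut open. *)
Let cut k j a (f : seq L -> F) (u : seq L) : F :=
  (-1) ^+ rot_sign par k (a :: drop j u) * f (rot k (a :: drop j u)) * D a (take j u).

Lemma exchange_triangle n (g : nat -> nat -> F) :
  \sum_(k < n.+1) \sum_(j < (n - k).+1) g k j
    = \sum_(j < n.+1) \sum_(k < (n - j).+1) g k j.
Proof.
have widen (h : nat -> F) k : (k <= n)%N ->
    \sum_(j < (n - k).+1) h j = \sum_(j < n.+1 | (k + j <= n)%N) h j.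
  move=> le_kn; rewrite (@big_ord_widen _ _ _ (n - k).+1 n.+1) ?ltnS ?leq_subr //.
  by apply: eq_bigl => j; rewrite ltnS; lia.
under eq_bigr => k _ do rewrite (widen (g k)) -1?ltnS //.
rewrite (exchange_big_dep predT) //=; apply: eq_bigr => j _.
rewrite (widen (g^~ j)) -1?ltnS //.
by apply: eq_bigl => k; rewrite addnC.
Qed.

Lemma der_even f u :
  der par D f u =
  \sum_(k < (size u).+1) \sum_(j < (size u - k).+1) \sum_(a : L) ins k j a f u.
Proof.
apply: eq_bigr => k _; apply: eq_bigr => j _; apply: eq_bigr => a _ /=; rewrite /ins.
have [->|/D_even ->] := eqVneq (D a (take j (drop k u))) 0; first by rewrite !mulr0.
by rewrite addbb /= mul1r.
Qed.

(** Under N the word may be rotated until the arc comes first. The [k] letters that stood before the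
    arc are then the last ones, so the contracted word is cut just before them, after [a] and the
    remaining letters. *)
Lemma Nsym_ins_cut k j a f t : (0 < k)%N -> (k + j <= size t)%N ->
  Nsym par (ins k j a f) t = Nsym par (cut (size t - (k + j)).+1 j a f) t.
Proof.
move=> k0 kj; set K := (size t - k)%N.
rewrite -(@Nsym_cyc _ _ _ K) ?leq_subr //; apply: eq_Nsym => i _.
set u := rot i t; have su : size u = size t by rewrite size_rot.
have dK : size (drop K u) = k by rewrite size_drop su /K; lia.
rewrite /ins /cut /=.
have -> : take k (rot K u) = drop K u by rewrite take_size_cat.
have -> : drop (k + j) (rot K u) = drop j (take K u).
  by rewrite addnC -drop_drop drop_size_cat.
have -> : take j (drop k (rot K u)) = take j u.
  by rewrite drop_size_cat // take_takel //; rewrite /K; lia.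
have jK : (j <= K)%N by rewrite /K; lia.
have tE : take (size t - (k + j)) (drop j u) = drop j (take K u).
  by rewrite take_drop; congr (drop _ (take _ _)); rewrite /K; lia.
have dE : drop (size t - (k + j)) (drop j u) = drop K u.
  by rewrite drop_drop; congr drop; rewrite /K; lia.
rewrite /rot /rot_sign /= tE dE mulrA.
have [->|/D_even Da] := eqVneq (D a (take j u)) 0; first by rewrite !mulr0.
congr (_ ^+ nat_of_bool (_ && _) * _ * _).
have {1}-> : take K u = take j u ++ drop j (take K u).
  by rewrite -{1}(cat_take_drop j (take K u)) take_takel.
by rewrite wparity_cat Da /wparity /= oddD; case: (par a).
Qed.

(* An arc of the cyclic word t and a cut of t outside the arc amount to a cut  *)
(* of the cyclic word in which the arc is contracted to one letter.            *)
Lemma Nsym_der f t :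
  Nsym par (der par D f) t =
  \sum_(i < size t) \sum_(j < (size t).+1) \sum_(a : L)
    (-1) ^+ rot_sign par i t * D a (take j (rot i t))
      * Nsym par f (a :: drop j (rot i t)).
Proof.
set n := size t.
transitivity (\sum_(k < n.+1) \sum_(j < (n - k).+1) \sum_(a : L)
    Nsym par (ins k j a f) t).
  rewrite (@eq_Nsym _ _ _ _ (fun u => \sum_(k < n.+1) \sum_(j < (n - k).+1) \sum_(a : L) ins k j a f u)).
    rewrite Nsym_sum; apply: eq_bigr => k _; rewrite Nsym_sum; apply: eq_bigr => j _.
    by rewrite Nsym_sum.
  by move=> i _; rewrite der_even size_rot.
rewrite (exchange_triangle n (fun k j => \sum_(a : L) Nsym par (ins k j a f) t)) /=.
transitivity (\sum_(j < n.+1) \sum_(k < (n - j).+1) \sum_(a : L)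
    Nsym par (cut k j a f) t).
  apply: eq_bigr => j _; rewrite exchange_big [RHS]exchange_big; apply: eq_bigr => a _.
  (* An arc at the front corresponds to the cut in front of [a]; the other positions of the arc
     match the other cuts in reverse order. *)
  rewrite !big_ord_recl; congr (_ + _).
    by apply: eq_Nsym => i _; rewrite /ins /cut /rot_sign /= ?take0 ?drop0 rot0 add0n /= ?take0 ?mul1r.

  rewrite (reindex_inj rev_ord_inj); apply: eq_bigr => k _ /=.
  rewrite Nsym_ins_cut //; last by rewrite /bump; have := ltn_ord k; lia.
  by congr (Nsym par (cut _ j a f) t); rewrite /bump; have := ltn_ord k; lia.
rewrite [RHS]exchange_big; apply: eq_bigr => j _.
rewrite exchange_big [RHS]exchange_big; apply: eq_bigr => a _.
under eq_bigr do rewrite Nsym_rot.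
rewrite exchange_big; apply: eq_bigr => i _.
rewrite Nsym_rot /= size_drop size_rot big_distrr /=; apply: eq_bigr => k _.
by rewrite /cut; ring.
Qed.

End EvenDerivation.

(** * The cyclic tensors of a symplectic A-infinity algebra *)

Section FormsOnGenerators.
Variables (F : fieldType) (I : finType) (par : I -> bool).
Local Open Scope ring_scope.

Let x_word (s : seq I) : seq (I * bool) := [seq (a, false) | a <- s].

Lemma wparity_x_word s : wparity (fpar par) (x_word s) = wparity par s.
Proof. by rewrite /wparity count_map; congr odd; apply: eq_count => a; rewrite /= /fpar addbF. Qed.

Lemma form_degree_x_word s : form_degree (x_word s) = 0%N.
Proof. by rewrite /form_degree count_map; elim: s. Qed.

Lemma form0_x_word (h : seq I -> F) s : form0 h (x_word s) = h s.
Proof. by rewrite /form0 form_degree_x_word -map_comp map_id. Qed.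

Lemma x_wordP (s : seq (I * bool)) : form_degree s = 0%N -> s = x_word (map fst s).
Proof. by elim: s => [|[a []] s IH] //= /IH <-. Qed.

(** The word has a single dx, so d must have acted exactly there; the sign is that of moving the odd
    operator d past [s1]. *)
Lemma dform_form0 (h : seq I -> F) s1 a s2 :
  dform par (form0 h) (x_word s1 ++ (a, true) :: x_word s2)
    = (-1) ^+ wparity par s1 * h (s1 ++ a :: s2).
Proof.
rewrite /dform /der; set t := (X in size X).
have st : size t = (size s1 + (size s2).+1)%N by rewrite size_cat /= !size_map.
have lti : (size s1 < (size t).+1)%N by rewrite st; lia.
have ltj : (1 < (size t - size s1).+1)%N by rewrite st; lia.
rewrite (bigD1 (Ordinal lti)) //= (bigD1 (Ordinal ltj)) //= (bigD1 (a, false)) //=.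
have tk : take (size s1) t = x_word s1 by rewrite take_size_cat ?size_map.
have dr : drop (size s1) t = (a, true) :: x_word s2 by rewrite drop_size_cat ?size_map.
have dr1 : drop (size s1 + 1) t = x_word s2 by rewrite addnC -drop_drop dr /= drop0.
rewrite tk dr dr1 /= take0 /word eqxx mulr1 wparity_x_word.
have -> : form0 h (x_word s1 ++ (a, false) :: x_word s2) = h (s1 ++ a :: s2).
  by rewrite -(form0_x_word h) /x_word map_cat.
have -> : fpar par (a, false) (+) wparity (fpar par) [:: (a, true)].
  by rewrite /wparity /= /fpar /=; case: (par a).
rewrite big1 => [|l la]; last first.
  case: l la => l [] /=; first by rewrite mulr0.
  by rewrite xpair_eqE andbT eqseq_cons xpair_eqE !andbT eq_sym => /negPf ->; rewrite mulr0.
rewrite big1 => [|j jn1]; last first.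
  rewrite big1 // => l _; case: ifP => _; rewrite ?mulr0 //.
  case: eqP => [E|]; last by rewrite mulr0.
  have := congr1 size E; rewrite size_take /= size_map; case: ifP => jl sj.
    by case/negP: jn1; apply/eqP/val_inj.
  have jlt := ltn_ord j.
  by case/negP: jn1; apply/eqP/val_inj => /=; lia.
rewrite big1 => [|i ini]; first by rewrite !addr0.
rewrite big1 // => j _; rewrite big1 // => l _.
case: ifP => _; rewrite ?mulr0 //; case: eqP => [E|]; last by rewrite mulr0.
case/negP: ini; apply/eqP/val_inj => /=.
have ltit : (i < size t)%N.
  by rewrite ltnNge; apply/negP => /drop_oversize D0; rewrite D0 in E.
have Ei : nth (a, false) t i = (l.1, true).
  have := congr1 (head (a, false)) E.
  by rewrite /= (drop_nth (a, false)) //; case: (j : nat) E.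
move: Ei; rewrite /t nth_cat size_map.
case: ltnP => [lt1|ge1]; first by rewrite (nth_map a).
case: (posnP (i - size s1)) => [i0 _|gt1].
  by apply/eqP; rewrite eqn_leq ge1 andbT -subn_eq0 i0.
rewrite -(prednK gt1) /= (nth_map a) //.
have : (i < size s1 + (size s2).+1)%N by rewrite -st.
by move: (nat_of_ord i) gt1 => k; lia.
Qed.

(** In a rotation, the sign of d passing the letters before dx_b, together with the change of the
    rotation sign caused by the shifted parity of dx_b, is the parity of all of [s]. It is therefore
    independent of the rotation and factors out. *)
Lemma Nsym_dform (h : seq I -> F) s b :
  Nsym (fpar par) (dform par (form0 h)) (rcons (x_word s) (b, true))
    = (-1) ^+ wparity par s * Nsym par h (rcons s b).
Proof.
rewrite !Nsym_rot !size_rcons size_map big_distrr /=; apply: eq_bigr => i _.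
have le_is : (i <= size s)%N by rewrite -ltnS.
have tr (T : Type) (u : seq T) x : (i <= size u)%N -> take i (rcons u x) = take i u.
  by move=> le_iu; rewrite -cats1 takel_cat.
have dr (T : Type) (u : seq T) x : (i <= size u)%N -> drop i (rcons u x) = rcons (drop i u) x.
  by move=> le_iu; rewrite -!cats1 drop_cat; case: ltngtP le_iu => // ->; rewrite subnn drop_size.
rewrite /rot /rot_sign !tr ?dr ?size_map // !cat_rcons -map_drop -map_take.
rewrite dform_form0 !mulrA; congr (_ * _); rewrite -!signr_addb; congr (_ ^+ nat_of_bool _).
have wr (T : Type) (p : T -> bool) u x : wparity p (rcons u x) = wparity p u (+) p x.
  by rewrite -cats1 wparity_cat /wparity /= addn0 oddb.
have ws : wparity par s = wparity par (take i s) (+) wparity par (drop i s).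
  by rewrite -wparity_cat cat_take_drop.
rewrite !wr !wparity_x_word ws /fpar /=; bool_taut.
Qed.

(** The normal form of d Theta(w): the sign comes from moving d past dx_a, whose parity is opposite
    to that of [a]. *)
Definition dd_form (w : seq I -> F) (s : seq (I * bool)) : F :=
  if s is [:: (a, true); (b, true)] then (-1) ^+ (~~ par a) * w [:: a; b] else 0.

Lemma dform_Theta (w : seq I -> F) s :
  (forall s, size s != 2%N -> w s = 0) -> dform par (Theta w) s = dd_form w s.
Proof.
move=> w2; rewrite /dform /der.
set T := fun i j l => (-1) ^+ ((fpar par l (+) wparity (fpar par) (take j (drop i s)))
    && wparity (fpar par) (take i s)) * Theta w (take i s ++ l :: drop (i + j) s)
  * (if l.2 then 0 else word F [:: (l.1, true)] (take j (drop i s))).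
have T_neq0 i j l : (j <= size s - i)%N -> T i j l != 0 ->
    [/\ i = 1, j = 1 & exists a, s = [:: (a, true); (l.1, true)] /\ l = (l.1, false)]%N.
  move=> le_j; rewrite /T; case: l => c [] /=; first by rewrite mulr0 eqxx.
  rewrite /word; case: (_ =P [:: (c, true)]) => [E|_]; last by rewrite mulr0 eqxx.
  rewrite mulr1n mulr1; have j1 : j = 1%N.
    by have := congr1 size E; rewrite size_takel // size_drop.
  have sE : s = take i s ++ (c, true) :: drop (i + j) s.
    by rewrite addnC -drop_drop -cat1s -E !cat_take_drop.
  have si : size (take i s) = i by rewrite size_takel //; lia.
  case E1: (take i s) sE si => [|[a []] s1] /= sE si; rewrite ?mulr0 ?eqxx //.
  case: ifP => _; last by rewrite mulr0 eqxx.
  have [sz _|/w2 ->] := boolP (size (a :: [seq l.1 | l <- s1 ++ (c, false) :: drop (i + j) s]) == 2%N);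
    last by rewrite mulr0 eqxx.
  move: sz si; rewrite /= size_map size_cat /= => sz si.
  have s10 : s1 = [::] by apply: size0nil; move: sz; lia.
  have d0 : drop (i + j) s = [::] by apply: size0nil; move: sz; lia.
  rewrite s10 in si; split=> //; exists a; split=> //.
  by rewrite sE s10 d0.
transitivity (\sum_(i < (size s).+1) \sum_(j < (size s - i).+1) \sum_l T i j l) => //.
have [/existsP[[a b] /eqP sE]|bad] :=
  boolP [exists p : I * I, s == [:: (p.1, true); (p.2, true)]]; last first.
  rewrite big1 => [|i _].
    move: bad; case: s {T T_neq0} => [|[a []] [|[b []] []]] // /existsP[].
    by exists (a, b).
  rewrite big1 // => j _; rewrite big1 // => l _; apply/eqP; apply: contraNT bad.
  case/T_neq0 => [|_ _ [a [sE _]]]; first by rewrite -ltnS.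
  by apply/existsP; exists (a, l.1); rewrite sE.
have only i j l : (j <= size s - i)%N -> T i j l != 0 -> [/\ i = 1, j = 1 & l = (b, false)]%N.
  by move=> le_j /(T_neq0 _ _ _ le_j)[-> -> [c []]]; rewrite sE => -[_ <-].
have i1 : (1 < (size s).+1)%N by rewrite sE.
have j1 : (1 < (size s - 1).+1)%N by rewrite sE.
rewrite (bigD1 (Ordinal i1)) //= (bigD1 (Ordinal j1)) //= (bigD1 (b, false)) //=.
rewrite big1 => [|l]; last first.
  move=> lb; apply/eqP; apply: contraNT lb => /only[].
    by rewrite sE.
  by move=> _ _ ->.
rewrite big1 => [|j]; last first.
  move=> jn1; rewrite big1 // => l _; apply/eqP; apply: contraNT jn1 => /only[].
    by rewrite -ltnS.
  by move=> _ j1' _; apply/eqP/val_inj.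
rewrite big1 => [|i]; last first.
  move=> in1; rewrite big1 // => j _; rewrite big1 // => l _; apply/eqP.
  apply: contraNT in1 => /only[]; first by rewrite -ltnS.
  by move=> i1' _ _; apply/eqP/val_inj.
rewrite !addr0 /T sE /= /word eqxx mulr1 /Theta /= /wparity /= !addn0 /fpar /=.
by rewrite !oddb; case: (par a); case: (par b).
Qed.

Lemma Nsym_dd_form_neq0 (w : seq I -> F) u :
  Nsym (fpar par) (dd_form w) u != 0 -> exists a b, u = [:: (a, true); (b, true)].
Proof.
move=> nz; suff: (size u == 2%N) && all snd u.
  by case: u {nz} => [|[a []] [|[b []] []]] // _; exists a, b.
apply/negPn/negP => bad; case/eqP: nz; rewrite Nsym_rot big1 // => i _.
suff -> : dd_form w (rot i u) = 0 by rewrite mulr0.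
have : ~~ ((size (rot i u) == 2%N) && all snd (rot i u)).
  by rewrite size_rot (eq_all_r (mem_rot _ _)).
by case: (rot i u) => [|[a []] [|[b []] []]].
Qed.

Lemma inner_productE (w : seq I -> F) a b :
  inner_product par w a b = w [:: a; b] - (-1) ^+ (par a && par b) * w [:: b; a].
Proof.
rewrite /inner_product; congr (_ - _).
have -> : [tuple a; b] = in_tuple [:: a; b] by apply: val_inj.
rewrite -[zcyc 2]expg1 (kact_zcyc _ _ (s := [:: a; b])) //=.
by rewrite /rot_sign /wparity /= !addn0 !oddb.
Qed.

Lemma Nsym_dd_form (w : seq I -> F) a b :
  Nsym (fpar par) (dd_form w) [:: (a, true); (b, true)]
    = (-1) ^+ (~~ par a) * inner_product par w a b.
Proof.
rewrite Nsym_rot inner_productE big_ord_recl big_ord1 /=.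
rewrite /rot_sign /rot /wparity /= !addn0 !oddb /fpar /= mul1r mulrBr; congr (_ + _).
rewrite !mulrA -!signr_addb -[_ ^+ _ * _]opprK; congr (- _).
by case: (par a); case: (par b); rewrite /= ?expr0 ?expr1 ?mul1r ?mulN1r ?opprK.
Qed.

(** The form enters [Nsym_der] only through its cyclic symmetrization, which lives on words of two
    dx's. Since the word has a single dx, the arc replaced by the field can only be all of [s]. *)
Lemma Nsym_contraction (xi : I -> seq I -> F) om w s b :
    vparity par true xi ->
    (forall u, Nsym (fpar par) om u = Nsym (fpar par) (dd_form w) u) ->
  Nsym (fpar par) (contraction par xi om) (rcons (x_word s) (b, true))
    = \sum_a xi a s * ((-1) ^+ (~~ par a) * inner_product par w a b).
Proof.
move=> xi_odd omE; set t := rcons _ _.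
have st : size t = (size s).+1 by rewrite size_rcons size_map.
rewrite Nsym_der; last first.
  case=> a [] /= u; last by rewrite eqxx.
  rewrite /form0; case: (form_degree u =P 0%N) => [u0|]; last by rewrite eqxx.
  by move=> /xi_odd; rewrite {2}(x_wordP u0) wparity_x_word => ->.
(* After contraction the word must be two dx's, and the only dx of [t] is its last letter: so the
   arc starts at the beginning of [t] and stops just before that letter. *)
have van i j (l : I * bool) : (i < size t)%N -> (j <= size t)%N ->
    Nsym (fpar par) om (l :: drop j (rot i t)) != 0 -> i = 0%N /\ j = size s.
  move=> it jt; rewrite omE => /Nsym_dd_form_neq0[a [c [_ E]]].
  have js : j = size s.
    by have := congr1 size E; rewrite size_drop size_rot st /=; move: jt; rewrite st; lia.
  split=> //; case: i it E => [|i] // it E.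
  have it' : (i < size s)%N by rewrite -ltnS -st.
  have dt : drop j (rot i.+1 t) = [:: (c, true)] by case: E.
  have : last (c, false) (rot i.+1 t) = (c, true).
    by rewrite -(cat_take_drop j (rot i.+1 t)) dt last_cat.
  rewrite /rot last_cat /t -cats1 takel_cat ?size_map // -map_take.
  by rewrite (take_nth b) // map_rcons last_rcons.
rewrite st big_ord_recl.
rewrite addrC big1 ?add0r => [|i _]; last first.
  rewrite big1 // => j _; rewrite big1 // => l _; apply/eqP.
  apply: contraTT isT => nz; have := van (bump 0 i) j l.
  rewrite st /bump /= add1n ltnS ltn_ord -ltnS ltn_ord.
  by case=> //; apply: contraNN nz => /eqP ->; rewrite mulr0.
rewrite (bigD1 (inord (size s))) //= addrC big1 ?add0r => [|j jn]; last first.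
  rewrite big1 // => l _; apply/eqP; apply: contraNT jn => nz.
  have := van 0%N j l; rewrite st (leq_ord j) => -[] // => [|_ js].
    by apply: contraNN nz => /eqP ->; rewrite mulr0.
  by apply/eqP/val_inj; rewrite /= inordK ?js.
rewrite inordK ?ltnS // rot0 /rot_sign take0 /=.
have -> : take (size s) t = x_word s by rewrite /t -cats1 take_size_cat ?size_map.
have -> : drop (size s) t = [:: (b, true)] by rewrite /t -cats1 drop_size_cat ?size_map.
rewrite (eq_bigr (fun l : I * bool => (if l.2 then form0 (xi l.1) (x_word s) else 0) * Nsym (fpar par) om [:: (l.1, l.2); (b, true)])); last first.
  by case=> a c _; rewrite mul1r.
rewrite -(pair_bigA _ (fun a c => (if c then form0 (xi a) (x_word s) else 0) * Nsym (fpar par) om [:: (a, c); (b, true)])) /=.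
apply: eq_bigr => a _; rewrite big_bool /= mul0r addr0 form0_x_word omE.
by rewrite Nsym_dd_form.
Qed.

End FormsOnGenerators.

Section Hamiltonian.
Variables (F : fieldType) (A : sympAinf F).
Variable w : seq 'I_(dimU A) -> F.
Hypothesis w_omega : order_zero_tensor w.
Local Open Scope ring_scope.
Local Notation par := (@ainf_par F A).

Lemma Nsym_omega u : Nsym (fpar par) (@omega F A) u = Nsym (fpar par) (dd_form par w) u.
Proof.
case: w_omega => w2 /(DReq_Nsym u) ->.
by apply: eq_Nsym => i _; rewrite dform_Theta.
Qed.

(** Compare the coefficients of x_s dx_b in N(dh) and N(i_m omega). As m is odd, the sign from d
    equals the sign in [dd_form], and the two cancel, leaving the tensor h_k. *)
Lemma Nsym_hamiltonian h s : hamiltonian h -> Nsym par h s = htensor w s.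
Proof.
case=> _ _ dh; case/lastP: s => [|s b]; first by rewrite Nsym_rot big_ord0.
have -> : htensor w (rcons s b) = \sum_a inner_product par w a b * mvf a s.
  case: s => [|x s] //=; apply: eq_bigr => a _.
  by rewrite last_rcons belast_rcons.
have := DReq_Nsym (rcons [seq (a, false) | a <- s] (b, true)) dh.
rewrite Nsym_dform (Nsym_contraction _ _ (@mvf_odd F A) Nsym_omega).
move/(congr1 ( *%R ((-1) ^+ wparity par s))); rewrite mulrA -signr_addb addbb mul1r => ->.
rewrite big_distrr /=; apply: eq_bigr => a _.
have [->|/(@mvf_odd F A) ->] := eqVneq (mvf a s) 0; first by rewrite !mul0r !mulr0.
rewrite addbT [RHS]mulrC mulrCA; congr (_ * _).
by rewrite mulrA -signr_addb addbb mul1r.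
Qed.

(** If [a] and [b] have different parities, then dx_a dx_b is an odd word, on which the cyclic
    symmetrization of an even form vanishes. *)
Lemma inner_product_even a b : even_form par (@omega F A) ->
  inner_product par w a b != 0 -> par a = par b.
Proof.
move=> /(DReq_Nsym [:: (a, true); (b, true)]) om_even; apply: contraNeq => ab.
apply/eqP; apply: (@mulfI _ ((-1) ^+ (~~ par a))); first by rewrite signr_eq0.
rewrite mulr0 -Nsym_dd_form -Nsym_omega om_even -[RHS](Nsym0 F (fpar par) [:: (a, true); (b, true)]).
apply: eq_Nsym => i _; rewrite (wparity_perm _ (permEl (perm_rot _ _))).
rewrite /wparity /= addn0 oddD !oddb /fpar /= -addbA [true (+) _]addbC.
by move: ab; case: (par a); case: (par b).
Qed.

Lemma htensor_odd s : even_form par (@omega F A) -> htensor w s != 0 -> wparity par s.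
Proof.
move=> om_even; case: s => [|b0 s]; first by rewrite eqxx.
rewrite /htensor lastI; set b := last b0 s; set t := belast b0 s.
have [/existsP[a]|] := boolP [exists a, inner_product par w a b * mvf a t != 0].
  rewrite mulf_eq0 negb_or => /andP[/(inner_product_even om_even) ab /(@mvf_odd F A) ta] _.
  by rewrite -cats1 wparity_cat ta ab /wparity /= addn0 oddb; case: (par b).
rewrite negb_exists => /forallP z; rewrite big1 ?eqxx // => a _.
by apply/eqP; rewrite -[_ == _]negbK z.
Qed.

End Hamiltonian.

(** * Linear maps *)

Section Push.
Variables (F : fieldType).
Local Open Scope ring_scope.

Lemma sum_tuple_cons (L : finType) n (g : seq L -> F) :
  \sum_(u : n.+1.-tuple L) g u = \sum_a \sum_(v : n.-tuple L) g (a :: v).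
Proof.
rewrite pair_big /= (reindex (fun p : L * n.-tuple L => [tuple of p.1 :: p.2])) //.
exists (fun u => (thead u, behead_tuple u)) => [[a v] _|u _] /=.
  by congr (_, _); apply: val_inj.
by rewrite -tuple_eta.
Qed.

Variables (L L' : finType) (M : L -> L' -> F).
Implicit Types (f g : seq L -> F) (s t : seq L').

Lemma push_zip f s :
  push M f s = \sum_(u : (size s).-tuple L) f u * \prod_(p <- zip u s) M p.1 p.2.
Proof.
apply: eq_bigr => u _; congr (_ * _).
rewrite [RHS](big_tuple _ _ (zip_tuple u (in_tuple s))); apply: eq_bigr => i _.
rewrite (tnth_nth (tnth u i, tnth (in_tuple s) i)) /= nth_zip ?size_tuple //=.
by rewrite -tnth_nth -(tnth_nth _ (in_tuple s)).
Qed.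

Lemma push_nil f : push M f [::] = f [::].
Proof.
rewrite /push (big_pred1 [tuple]) => [|u]; first by rewrite big_ord0 mulr1.
by rewrite (tuple0 u); apply/esym/eqP/val_inj.
Qed.

Lemma push_cons f b s :
  push M f (b :: s) = \sum_a M a b * push M (fun u => f (a :: u)) s.
Proof.
pose g (u : seq L) := f u * \prod_(p <- zip u (b :: s)) M p.1 p.2.
rewrite push_zip; transitivity (\sum_(u : (size s).+1.-tuple L) g u) => //.
rewrite sum_tuple_cons; apply: eq_bigr => a _; rewrite push_zip big_distrr /=.
by apply: eq_bigr => u _; rewrite /g /= big_cons mulrCA.
Qed.

Lemma eq_push f g s :
  (forall u, size u = size s -> f u = g u) -> push M f s = push M g s.
Proof. by move=> fg; apply: eq_bigr => u _; rewrite fg ?size_tuple. Qed.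

Lemma pushZ c f s : push M (fun u => c * f u) s = c * push M f s.
Proof. by rewrite [RHS]big_distrr; apply: eq_bigr => u _; rewrite /= mulrA. Qed.

Lemma push_sum (J : Type) (r : seq J) (P : pred J) (h : J -> seq L -> F) s :
  push M (fun u => \sum_(j <- r | P j) h j u) s
    = \sum_(j <- r | P j) push M (h j) s.
Proof. by rewrite exchange_big; apply: eq_bigr => u _; rewrite big_distrl. Qed.

Lemma push_cat f s t :
  push M f (s ++ t) = push M (fun u => push M (fun v => f (u ++ v)) t) s.
Proof.
elim: s f => [|b s IH] f; first by rewrite push_nil.
by rewrite cat_cons !push_cons; apply: eq_bigr => a _; rewrite IH.
Qed.

Lemma push_exchange (g : seq L -> seq L -> F) s t :
  push M (fun u => push M (g u) t) s = push M (fun v => push M (g^~ v) s) t.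
Proof.
rewrite /push; under eq_bigr do rewrite big_distrl /=.
rewrite exchange_big; apply: eq_bigr => v _; rewrite big_distrl.
by apply: eq_bigr => u _; rewrite mulrAC.
Qed.

Lemma push_rot i f s : push M f (rot i s) = push M (fun u => f (rot i u)) s.
Proof.
rewrite -{2}(cat_take_drop i s) /rot !push_cat push_exchange.
apply: eq_push => u su; apply: eq_push => v sv.
have [le_is|lt_si] := leqP i (size s).
  have ui : size u = i by rewrite su size_takel.
  by rewrite drop_size_cat // take_size_cat.
have /size0nil -> : size v = 0%N by rewrite sv size_drop; lia.
rewrite cats0 drop_oversize ?take_oversize //= su size_take; case: ifP => //; lia.
Qed.

Section ParityPreserving.
Variables (par : L -> bool) (par' : L' -> bool).
Hypothesis M_par : forall a b, M a b != 0 -> par' b = par a.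

Lemma eq_push_par f g s :
  (forall u, map par u = map par' s -> f u = g u) -> push M f s = push M g s.
Proof.
elim: s f g => [|b s IH] f g fg; first by rewrite !push_nil fg.
rewrite !push_cons; apply: eq_bigr => a _.
have [->|/M_par ab] := eqVneq (M a b) 0; first by rewrite !mul0r.
by congr (_ * _); apply: IH => u us; apply: fg; rewrite /= us ab.
Qed.

Lemma wparity_id (T : Type) (p : T -> bool) (u : seq T) : wparity p u = wparity id (map p u).
Proof. by rewrite /wparity count_map. Qed.

Lemma push_wparity f s :
  push M f s = push M (fun u => if wparity par u == wparity par' s then f u else 0) s.
Proof. by apply: eq_push_par => u us; rewrite (wparity_id par) (wparity_id par') us eqxx. Qed.

Lemma push_Nsym f s : push M (Nsym par f) s = Nsym par' (push M f) s.
Proof.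
rewrite Nsym_rot (@eq_push _ (fun u => \sum_(i < size s) (-1) ^+ rot_sign par i u * f (rot i u))).
  rewrite push_sum; apply: eq_bigr => i _; rewrite push_rot -pushZ.
  apply: eq_push_par => u us; rewrite /rot_sign !(wparity_id par) !(wparity_id par').
  by rewrite !map_take !map_drop us.
by move=> u us; rewrite Nsym_rot us.
Qed.

End ParityPreserving.

Lemma prod_push h (ws : seq (seq L')) :
  \prod_(s <- ws) push M h s
    = push M (fun u => \prod_(v <- reshape (shape ws) u) h v) (flatten ws).
Proof.
elim: ws => [|s ws IH]; first by rewrite push_nil !big_nil.
rewrite big_cons IH /= push_cat mulrC -pushZ; apply: eq_push => u us.
rewrite mulrC -pushZ; apply: eq_push => v _.
by rewrite -us take_size_cat // drop_size_cat // big_cons.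
Qed.

Lemma push2 f b b' :
  push M f [:: b; b'] = \sum_a \sum_a' f [:: a; a'] * M a b * M a' b'.
Proof.
rewrite push_cons; apply: eq_bigr => a _; rewrite push_cons big_distrr /=.
by apply: eq_bigr => a' _; rewrite push_nil; ring.
Qed.

End Push.

(** A product of pairings of consecutive letters is pulled back two letters at a time. The
    transposed matrix occurs because [push] here runs from [L'] back to [L]. *)
Lemma push_pairing (F : fieldType) (L L' : finType) (M : L -> L' -> F)
    (B : L -> L -> F) (B' : L' -> L' -> F) (s : seq L) :
    (forall a a', B a a' = \sum_b \sum_b' B' b b' * M a b * M a' b')%R ->
    ~~ odd (size s) ->
  push (fun b a => M a b) (pairing_word B') s = pairing_word B s.
Proof.
move=> BB'; have [k] := ubnP (size s); elim: k s => // k IH [|a [|a' s]] //= ks.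
  by rewrite push_nil.
rewrite negbK => os; rewrite push_cons BB' big_distrl /=; apply: eq_bigr => b _.
rewrite push_cons big_distrr big_distrl /=; apply: eq_bigr => b' _.
by rewrite pushZ IH //; [ring | lia].
Qed.

(** * Contractions as sums over colorings *)

Lemma uniq_flatten_map (T K : eqType) (f : T -> seq K) (r : seq T) :
    uniq r -> {in r, forall x, uniq (f x)} ->
    {in r &, forall x y z, z \in f x -> z \in f y -> x = y} ->
  uniq (flatten (map f r)).
Proof.
elim: r => //= x r IH /andP[xr ur] fu fI; rewrite cat_uniq fu ?mem_head //=.
apply/andP; split.
  apply/hasPn => z /flatten_mapP[y yr zy]; apply: contra xr => zx.
  by rewrite (fI x y _ _ z) ?mem_head // inE yr orbT.
apply: IH => // [y yr|y y' yr yr'].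
  by apply: fu; rewrite inE yr orbT.
by apply: fI; rewrite inE ?yr ?yr' orbT.
Qed.

Section ListsOfHalfEdges.
Variables (G : graph) (Gt : full_order G).
Local Notation H := (hedge G).

(** The half-edges in the order i_1, j_1, i_2, j_2, ..., that is, the arrangement into which sigma_c
    moves the order along the vertices. *)
Definition chord_list : seq H := flatten [seq [:: p.1; p.2] | p <- enum (fo_order Gt).2].

Lemma mem_fo_verts v : (v \in (fo_order Gt).1) = (v \in verts G).
Proof. by case/and3P: (fo_valid Gt) => /eqP/setP/(_ v); rewrite inE. Qed.

Lemma uniq_fo_verts : uniq (fo_order Gt).1.
Proof.
apply/card_uniqP; rewrite size_tuple -(cardsE (mem (fo_order Gt).1)).
by apply: eq_card => v; rewrite !inE mem_fo_verts.
Qed.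

Lemma uniq_fo_lists : uniq (flatten (fo_lists Gt)).
Proof.
case/and3P: (verts_partition G) => _ /trivIsetP tI _.
apply: uniq_flatten_map uniq_fo_verts _ _ => [v|v v']; rewrite mem_fo_verts => vG.
  exact: fo_uniq.
rewrite mem_fo_verts => v'G z; rewrite !fo_mem // => zv zv'.
apply/eqP; apply: contraTT zv' => vv'.
by rewrite (disjointFr (tI _ _ vG v'G vv') zv).
Qed.

Lemma mem_fo_lists h : h \in flatten (fo_lists Gt).
Proof.
have : h \in cover (verts G) by rewrite (cover_partition (verts_partition G)) inE.
case/bigcupP => v vG hv; apply/flatten_mapP.
by exists v; rewrite ?mem_fo_verts // fo_mem.
Qed.

Lemma chord_edge p : p \in enum (fo_order Gt).2 ->
  [set p.1; p.2] \in edges G /\ p.1 != p.2.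
Proof.
rewrite mem_enum => pG; case/and3P: (fo_valid Gt) => _ /forallP/(_ p)/implyP/(_ pG) pE _.
by split=> //; move: (edges_card pE); rewrite cards2; case: eqP.
Qed.

Lemma uniq_chord_list : uniq chord_list.
Proof.
case/and3P: (edges_partition G) => _ /trivIsetP tI _.
apply: uniq_flatten_map (enum_uniq _) _ _ => [p /chord_edge[_ p12]|p p' pG p'G z zp zp'].
  by rewrite /= inE p12.
have [pE _] := chord_edge pG; have [p'E _] := chord_edge p'G.
have pp' : [set p.1; p.2] = [set p'.1; p'.2].
  apply/eqP; apply: contraTT zp' => /(tI _ _ pE p'E) d.
  have : z \in [set p.1; p.2] by move: zp; rewrite !inE.
  by move/(disjointFr d); rewrite !inE => ->.
case/and3P: (fo_valid Gt) => _ _ /forallP/(_ [set p.1; p.2])/implyP/(_ pE)/cards1P[q qE].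
rewrite mem_enum in pG; rewrite mem_enum in p'G.
have : p \in [set q] by rewrite -qE inE pG eqxx.
have : p' \in [set q] by rewrite -qE inE p'G pp' eqxx.
by rewrite !inE => /eqP -> /eqP ->.
Qed.

Lemma mem_chord_list h : h \in chord_list.
Proof.
have : h \in cover (edges G) by rewrite (cover_partition (edges_partition G)) inE.
case/bigcupP => e eG he.
case/and3P: (fo_valid Gt) => _ _ /forallP/(_ e)/implyP/(_ eG)/cards1P[p pE].
have : p \in [set p in (fo_order Gt).2 | [set p.1; p.2] == e] by rewrite pE set11.
rewrite inE => /andP[pG /eqP pe]; apply/flatten_mapP; exists p; first by rewrite mem_enum.
by move: he; rewrite -pe !inE.
Qed.

End ListsOfHalfEdges.

Section Colorings.
Variables (F : fieldType) (K L : finType) (par : L -> bool) (B : L -> L -> F).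
Local Open Scope ring_scope.

Lemma size_enumeration (s : seq K) : uniq s -> (forall h, h \in s) -> size s = #|K|.
Proof. by move=> us sK; rewrite cardE; apply/perm_size/uniq_perm; rewrite ?enum_uniq // => h; rewrite sK mem_enum. Qed.

Lemma sum_coloring (s : seq K) n (g : seq L -> F) :
    uniq s -> (forall h, h \in s) -> size s = n ->
  \sum_(u : n.-tuple L) g u = \sum_(c : {ffun K -> L}) g (map c s).
Proof.
move=> us sK sn; have szP (c : K -> L) : size (map c s) == n by rewrite size_map sn.
have iP h : (index h s < n)%N by rewrite -sn index_mem.
rewrite (reindex (fun c : {ffun K -> L} => Tuple (szP c))) //.
exists (fun u : n.-tuple L => [ffun h => tnth u (Ordinal (iP h))]) => [c _|u _].
  apply/ffunP => h; rewrite ffunE (tnth_nth (c h)) /= (nth_map h) ?sn // nth_index //.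
apply: eq_from_tnth => i; have lti : (i < size s)%N by rewrite sn.
case: s us sK sn szP iP lti => // h0 s us sK sn szP iP lti.
rewrite (tnth_nth (tnth u i)) (nth_map h0) // ffunE.
by congr tnth; apply: val_inj; exact: index_uniq lti us.
Qed.

(* A tensor factor is addressed by its half-edge instead of its position, so   *)
(* that an arrangement ll of the half-edges enters only through its sign and   *)
(* the argument of x.                                                          *)
Definition coloring_sum (chl : seq K) (x : seq (seq L) -> F) (ll : seq (seq K)) : F :=
  \sum_(c : {ffun K -> L}) pairing_word B (map c chl)
    * (-1) ^+ (inv_parity (par \o c) chl (+) inv_parity (par \o c) (flatten ll))
    * x (map (map c) ll).

End Colorings.

Section ContractColoring.
Variables (G : graph) (Gt : full_order G).
Variables (F : fieldType) (L : finType) (par : L -> bool) (B : L -> L -> F).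
Local Open Scope ring_scope.
Local Notation H := (hedge G).

Lemma size_fo_lists : size (flatten (fo_lists Gt)) = #|H|.
Proof. exact: size_enumeration (uniq_fo_lists Gt) (mem_fo_lists Gt). Qed.

Lemma size_chord_list : size (chord_list Gt) = #|H|.
Proof. exact: size_enumeration (uniq_chord_list Gt) (mem_chord_list Gt). Qed.

Lemma val_hnumber h : hnumber Gt h = index h (flatten (fo_lists Gt)) :> nat.
Proof.
have lth : (index h (flatten (fo_lists Gt)) < #|H|)%N.
  by rewrite -size_fo_lists index_mem mem_fo_lists.
by rewrite /hnumber val_insubd lth.
Qed.

Lemma hnumber_inj : injective (hnumber Gt).
Proof.
move=> h h' /(congr1 val); rewrite /= !val_hnumber => /(congr1 (nth h (flatten (fo_lists Gt)))).
by rewrite !nth_index ?mem_fo_lists.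
Qed.

Lemma val_sigma_chord h :
  sigma_chord Gt (hnumber Gt h) = index h (chord_list Gt) :> nat.
Proof.
have lth : (index h (chord_list Gt) < #|H|)%N.
  by rewrite -size_chord_list index_mem mem_chord_list.
rewrite /sigma_chord val_insubd.
have -> : flatten [seq [:: c.1; c.2] | c <- chord_diagram Gt] = map (hnumber Gt) (chord_list Gt).
  by rewrite map_flatten -!map_comp.
by rewrite (index_map hnumber_inj) lth.
Qed.

(** A tuple of letters is read as a coloring along [chord_list]. Since sigma_c carries the vertex
    order to the chord order, the argument of [x] is the same coloring read along the vertices, and
    [ksign_letter] gives the sign. *)
Lemma contract_coloring (x : seq (seq L) -> F) :
  contract par B Gt x = coloring_sum par B (chord_list Gt) x (fo_lists Gt).
Proof.
set fl := flatten (fo_lists Gt); set chl := chord_list Gt.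
have flP : size fl == #|H| by rewrite size_fo_lists.
have chlP : size chl == #|H| by rewrite size_chord_list.
(* The summand must be a function of plain sequences for [sum_coloring]; the default 0 is never
   reached, as all sequences summed over have length #|H|. *)
pose g (u : seq L) := pairing_word B u *
  (if insub u is Some u' then kact par (sigma_chord Gt)
    (fun v => x (reshape (fo_type Gt) v)) (u' : #|H|.-tuple L) else 0).
transitivity (\sum_(u : #|H|.-tuple L) g u).
  by apply: eq_bigr => u _; rewrite /g valK.
rewrite (sum_coloring _ (uniq_chord_list Gt) (mem_chord_list Gt) size_chord_list).
apply: eq_bigr => c _; rewrite /g -mulrA; congr (_ * _).
have cP : size (map c chl) == #|H| by rewrite size_map.
rewrite (insubT (fun s => size s == #|H|) cP) /=.
have sE i : tnth (Tuple flP) i = tnth (Tuple chlP) (sigma_chord Gt i).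
  set h := tnth _ i; have hi : hnumber Gt h = i.
    apply: val_inj; rewrite /= val_hnumber /h (tnth_nth h) index_uniq ?uniq_fo_lists //.
    by rewrite size_fo_lists.
  rewrite -hi (tnth_nth h) val_sigma_chord nth_index ?mem_chord_list //.
have sI : injective (sigma_chord Gt).
  move=> i j ij; apply/(tuple_uniqP (Tuple flP)); first exact: uniq_fo_lists.
  by rewrite !sE ij.
rewrite /kact; set v := [tuple _ | i < _].
have vE : v = map c fl :> seq L.
  have -> : map c fl = [tuple of map c (Tuple flP)] by [].
  congr tval; apply: eq_from_tnth => i; rewrite tnth_mktuple tnth_map sE.
  set j := sigma_chord Gt i; rewrite (tnth_nth (c (tnth (Tuple flP) i))) /=.
  rewrite (nth_map (tnth (Tuple flP) i)) ?size_chord_list //.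
  by rewrite [in RHS](tnth_nth (tnth (Tuple flP) i)).
congr (_ * _); last first.
  have shE : fo_type Gt = shape (map (map c) (fo_lists Gt)).
    by rewrite /shape -map_comp; apply: eq_map => l; rewrite /= size_map.
  by rewrite vE /fl map_flatten shE flattenK.
rewrite (@eq_ksign _ _ _ _ (par \o c) _ _ _ (Tuple flP)) => [|i].
  by rewrite (ksign_letter _ _ sI sE) ?uniq_chord_list // addbC.
have -> : v = [tuple of map c (Tuple flP)] by apply: val_inj.
by rewrite tnth_map.
Qed.

End ContractColoring.

(** * Expanding the symmetrizations over arrangements of half-edges *)

Section Expansion.
Variables (F : fieldType) (K : finType) (L : finType) (par : L -> bool).
Local Open Scope ring_scope.
Implicit Types (ll m : seq (seq K)) (x : seq (seq L) -> F) (c : K -> L).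

Fixpoint rotations ll : seq (seq (seq K)) :=
  if ll is l :: ll' then [seq rot i l :: m | i <- index_iota 0 (size l), m <- rotations ll']
  else [:: [::]].

Lemma rotations_shape ll m : m \in rotations ll -> shape m = shape ll.
Proof.
elim: ll m => [|l ll IH] m /=; first by rewrite inE => /eqP ->.
by case/allpairsP => -[i m'] [_ /IH m'E ->] /=; rewrite size_rot m'E.
Qed.

Lemma rotations_perm ll m : m \in rotations ll -> perm_eq (flatten m) (flatten ll).
Proof.
elim: ll m => [|l ll IH] m /=; first by rewrite inE => /eqP ->.
by case/allpairsP => -[i m'] [_ /IH m'E ->] /=; rewrite perm_cat ?perm_rot.
Qed.

Lemma Nsym_all_rotations x c ll : uniq (flatten ll) ->
  Nsym_all par x (map (map c) ll) =
  \sum_(m <- rotations ll)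
    (-1) ^+ (inv_parity (par \o c) (flatten m) (+) inv_parity (par \o c) (flatten ll))
    * x (map (map c) m).
Proof.
elim: ll x => [|l ll IH] x /=; first by rewrite big_seq1 addbb mul1r.
rewrite cat_uniq => /and3P[ul _ ull]; rewrite IH // big_allpairs_dep exchange_big /=.
rewrite !big_seq; apply: eq_bigr => m mll.
rewrite Nsym_rot size_map big_mkord big_distrr; apply: eq_bigr => i _ /=.
rewrite -map_rot mulrA -signr_addb; congr (_ ^+ nat_of_bool _ * _).
have pl : perm_eq (rot i l) l by rewrite perm_rot.
have := inv_parity_catl (par \o c) (flatten m) pl.
have := inv_parity_catr (par \o c) l (rotations_perm mll).
rewrite inv_parity_rot // addbAC addbb addFb /rot_sign -map_take -map_drop !wparity_map => <- <-.
by rewrite addbC -addbA addKb.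
Qed.

Lemma antisym_tuple x n (t : n.-tuple (seq L)) :
  antisym par x t = \sum_(s : 'S_n) (-1) ^+ s * kact (wparity par) s x t.
Proof.
case: t => ws wsn; move/eqP: (wsn) => wsE; subst n.
by apply: eq_bigr => s _; congr (_ * kact _ _ _ _); apply: val_inj.
Qed.

Definition permute n (s : 'S_n) (t : n.-tuple (seq K)) : n.-tuple (seq K) :=
  [tuple tnth t (s i) | i < n].

Lemma antisym_permute x c n (t : n.-tuple (seq K)) : uniq (flatten t) ->
  antisym par x (map (map c) t) =
  \sum_(s : 'S_n) (-1) ^+ s
    * ((-1) ^+ (inv_parity (par \o c) (flatten (permute s t))
            (+) inv_parity (par \o c) (flatten t))
      * x (map (map c) (permute s t))).
Proof.
move=> ut; have -> : map (map c) t = [tuple of map (map c) t] by [].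
rewrite antisym_tuple; apply: eq_bigr => s _; congr (_ * _); rewrite /kact.
set v := [tuple _ | i < _]; have -> : v = [tuple of map (map c) (permute s t)].
  by apply: eq_from_tnth => i; rewrite !(tnth_mktuple, tnth_map).
congr (_ * _); rewrite -(@ksign_block _ _ _ _ s) //; last first.
- by move=> i; rewrite tnth_mktuple.
- exact: perm_inj.
by apply: eq_ksign => i; rewrite tnth_map wparity_map.
Qed.

Lemma permute_perm n (s : 'S_n) t : perm_eq (permute s t) t.
Proof. by apply/tuple_permP; exists s. Qed.

(** The signs of chords to [t], [t] to its permutation, and permutation to rotation compose to the
    sign of chords to [m], which is the one built into [coloring_sum]. Only sgn(s) survives. *)
Lemma coloring_sum_expand (B : L -> L -> F) chl x n (t : n.-tuple (seq K)) :
    uniq (flatten t) ->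
  coloring_sum par B chl (antisym par (Nsym_all par x)) t =
  \sum_(s : 'S_n) (-1) ^+ s *
    \sum_(m <- rotations (permute s t)) coloring_sum par B chl x m.
Proof.
move=> ut; rewrite /coloring_sum.
under eq_bigr => c _ do rewrite antisym_permute // big_distrr.
rewrite exchange_big /=; apply: eq_bigr => s _.
rewrite exchange_big big_distrr /=; apply: eq_bigr => c _.
have us : uniq (flatten (permute s t)).
  by rewrite (perm_uniq (perm_flatten (permute_perm s t))).
rewrite Nsym_all_rotations // !big_distrr /=; apply: eq_bigr => m _.
set a := inv_parity _ chl; set b := inv_parity _ _; set d := inv_parity _ _.
set e := inv_parity _ _; set y := x _; set z := pairing_word _ _.
have -> : (-1) ^+ (a (+) e) = (-1) ^+ (a (+) b) * (-1) ^+ (d (+) b) * (-1) ^+ (e (+) d) :> F.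
  rewrite -!signr_addb; congr (_ ^+ nat_of_bool _).
  by case: (a); case: (b); case: (d); case: (e).
set u1 := (-1) ^+ (a (+) b); set u2 := (-1) ^+ (d (+) b); set u3 := (-1) ^+ (e (+) d).
by rewrite -!mulrA; move: ((-1) ^+ s) => sg; clearbody u1 u2 u3 y z; ring.
Qed.

End Expansion.

(** * Linear derivations and invariance of the pairing *)

Section LetterDerivation.
Variables (F : fieldType) (L : finType) (par : L -> bool).
Variables (p : bool) (xi : L -> L -> F).
Local Open Scope ring_scope.

(** Recursive form of the derivation of a linear field of parity [p]: an operator of parity [p]
    passes the letters one by one. *)
Fixpoint letter_der (f : seq L -> F) (t : seq L) : F :=
  if t is b :: t' then
    \sum_a xi a b * f (a :: t')
      + (-1) ^+ (p && par b) * letter_der (fun u => f (b :: u)) t'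
  else 0.

Lemma letter_derZ k f t : letter_der (fun u => k * f u) t = k * letter_der f t.
Proof.
elim: t f => [|b t IH] f /=; first by rewrite mulr0.
rewrite IH mulrDr big_distrr mulrCA; congr (_ + _).
by apply: eq_bigr => a _; rewrite mulrCA.
Qed.

Lemma der_letter f t : (forall a b, xi a b != 0 -> par b = par a (+) p) ->
  der par (fun a s => if s is [:: b] then xi a b else 0) f t = letter_der f t.
Proof.
move=> xi_par; elim: t f => [|b t IH] f.
  by rewrite /der /= !big_ord_recl !big_ord0 !addr0 big1 // => a _; rewrite mulr0.
rewrite /= -IH /der [LHS]big_ord_recl; congr (_ + _).
  rewrite /= !big_ord_recl big1 => [|a _]; last by rewrite mulr0.
  rewrite add0r addrC big1 ?add0r => [|j _].
    by apply: eq_bigr => a _; rewrite /= take0 drop0 andbF mul1r mulrC.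
  rewrite big1 // => a _; case: t j {IH} => [|b' t] [j jt] //=.
  by rewrite mulr0.
rewrite big_distrr; apply: eq_bigr => i _ /=.
rewrite subSS big_distrr; apply: eq_bigr => j _ /=.
rewrite big_distrr; apply: eq_bigr => a _ /=.
case E: (take j (drop i t)) => [|b' [|]]; rewrite ?mulr0 //.
have [->|/xi_par Eb] := eqVneq (xi a b') 0; first by rewrite !mulr0.
rewrite !mulrA -signr_addb; congr (_ ^+ nat_of_bool _ * _ * _).
rewrite /wparity /= addn0 oddb Eb oddD oddb.
by case: (par a); case: p; case: (par b); case: (odd _).
Qed.

End LetterDerivation.

(** Invariance of the form kills the terms in each consecutive pair, hence the whole product by
    induction over pairs. *)
Lemma letter_der_pairing (F : fieldType) (L : finType) (par : L -> bool) p
    (xi : L -> L -> F) (B : L -> L -> F) t :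
    (forall a b, \sum_c xi a c * B c b
        + (-1) ^+ (p && par a) * \sum_c xi b c * B a c = 0)%R ->
    ~~ odd (size t) ->
  letter_der par p (fun b a => xi a b) (pairing_word B) t = 0%R.
Proof.
move=> inv; have [k] := ubnP (size t); elim: k t => // k IH [|a [|b t]] //= tk.
rewrite negbK => ot; rewrite letter_derZ IH //; last by lia.
rewrite !mulr0 addr0.
transitivity ((\sum_c xi a c * B c b + (-1) ^+ (p && par a) * \sum_c xi b c * B a c)
    * pairing_word B t)%R; last by rewrite inv mul0r.
rewrite mulrDl -mulrA !big_distrl /=.
by congr (_ + _ * _)%R; apply: eq_bigr => c _; rewrite mulrA.
Qed.

Section Update.
Variables (K L : finType).

Definition update (c : {ffun K -> L}) h a : {ffun K -> L} :=
  [ffun k => if k == h then a else c k].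

Lemma map_update_notin c h a s : h \notin s -> map (update c h a) s = map c s.
Proof.
by move=> hs; apply/eq_in_map => k ks; rewrite ffunE; case: eqP ks hs => // -> ->.
Qed.

Lemma update_update c h a b : update (update c h a) h b = update c h b.
Proof. by apply/ffunP => k; rewrite !ffunE; case: eqP. Qed.

Lemma update_id c h : update c h (c h) = c.
Proof. by apply/ffunP => k; rewrite ffunE; case: eqP => // ->. Qed.

Lemma updateE c h a : update c h a h = a.
Proof. by rewrite ffunE eqxx. Qed.

Lemma letter_der_coloring (F : fieldType) (par : L -> bool) p (xi : L -> L -> F)
    f (c : {ffun K -> L}) (s : seq K) : uniq s ->
  letter_der par p xi f (map c s) =
  (\sum_(h <- s) \sum_a (-1) ^+ (p && wparity (par \o c) (take (index h s) s))
     * xi a (c h) * f (map (update c h a) s))%R.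
Proof.
elim: s f => [|k s IH] f /=; first by rewrite big_nil.
case/andP=> ks us; rewrite big_cons eqxx IH //; congr (_ + _)%R.
  by apply: eq_bigr => a _; rewrite take0 andbF mul1r updateE map_update_notin.
rewrite big_distrr !big_seq; apply: eq_bigr => h hs /=.
have kh : k != h by apply: contraNneq ks => ->.
rewrite (negPf kh) big_distrr; apply: eq_bigr => a _ /=.
rewrite ffunE (negPf kh) !mulrA -signr_addb; congr (_ ^+ nat_of_bool _ * _ * _)%R.
by rewrite /wparity /= oddD oddb; case: (p); case: (par _).
Qed.

(* The right-hand correction does not depend on s: changing the parity of h    *)
(* and moving an odd operator to h changes all arrangements by the same sign.  *)
Lemma inv_parity_update (q q' : K -> bool) p h s :
    uniq s -> (forall k, k \in s) -> q' =1 (fun k => if k == h then q h (+) p else q k) ->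
  inv_parity q' s (+) (p && wparity q (take (index h s) s)) =
  inv_parity q s (+) (p && \big[addb/false]_(y | (enum_rank y < enum_rank h)%N) q y).
Proof.
move=> us sK q'E; have hs := sK h.
have -> : \big[addb/false]_(y | (enum_rank y < enum_rank h)%N) q y
    = \big[addb/false]_(y <- s | (enum_rank y < enum_rank h)%N) q y.
  apply/esym/perm_big/uniq_perm => //; first exact: index_enum_uniq.
  by move=> y; rewrite sK mem_index_enum.
have [s1 [s2 sE]] : exists s1 s2, s = s1 ++ h :: s2.
  by case/splitPr: hs => s1 s2; exists s1, s2.
have [hs1 hs2] : h \notin s1 /\ h \notin s2.
  by move: us; rewrite sE cat_uniq /= negb_or => /and4P[_ /andP[-> _] -> _].
have -> : take (index h s) s = s1.
  by rewrite sE index_cat (negPf hs1) /= eqxx addn0 take_size_cat.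
have qE (t : seq K) : h \notin t -> {in t, q' =1 q}.
  by move=> ht k kt; rewrite q'E; case: eqP ht kt => // -> /negPf ->.
have invE (q0 : K -> bool) : inv_parity q0 s =
    inv_parity q0 (s1 ++ s2) (+) (q0 h && (\big[addb/false]_(y <- s2 | (enum_rank y < enum_rank h)%N) q0 y
      (+) \big[addb/false]_(y <- s1 | (enum_rank h < enum_rank y)%N) q0 y)).
  rewrite sE !inv_parity_cat /inv_parity /= /cross_parity.
  have -> : \big[addb/false]_(x <- s1) \big[addb/false]_(y <- h :: s2) odd_inv q0 x y
      = \big[addb/false]_(x <- s1) odd_inv q0 x h
        (+) \big[addb/false]_(x <- s1) \big[addb/false]_(y <- s2) odd_inv q0 x y.
    by rewrite -big_split; apply: eq_bigr => x _; rewrite big_cons.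
  have -> : \big[addb/false]_(y <- s2) odd_inv q0 h y
      = q0 h && \big[addb/false]_(y <- s2 | (enum_rank y < enum_rank h)%N) q0 y.
    rewrite [X in _ && X]big_mkcond big_distrr; apply: eq_bigr => y _ /=.
    by rewrite /odd_inv; case: ifP; case: (q0 h).
  have -> : \big[addb/false]_(x <- s1) odd_inv q0 x h
      = q0 h && \big[addb/false]_(y <- s1 | (enum_rank h < enum_rank y)%N) q0 y.
    rewrite [X in _ && X]big_mkcond big_distrr; apply: eq_bigr => y _ /=.
    by rewrite /odd_inv; case: ifP; case: (q0 h); case: (q0 y).
  bool_taut.
have inv12 : inv_parity q' (s1 ++ s2) = inv_parity q (s1 ++ s2).
  have q12 : {in s1 ++ s2, q' =1 q} by apply: qE; rewrite mem_cat negb_or hs1.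
  exact: eq_inv_parity.
have qB (t : seq K) P : h \notin t ->
    \big[addb/false]_(y <- t | P y) q' y = \big[addb/false]_(y <- t | P y) q y.
  move=> ht; rewrite big_seq_cond [RHS]big_seq_cond; apply: eq_bigr => y /andP[yt _].
  exact: qE ht y yt.
have -> : wparity q s1 = \big[addb/false]_(y <- s1 | (enum_rank h < enum_rank y)%N) q y
    (+) \big[addb/false]_(y <- s1 | (enum_rank y < enum_rank h)%N) q y.
  rewrite wparity_big [X in _ = X (+) _]big_mkcond [X in _ = _ (+) X]big_mkcond -big_split.
  rewrite !big_seq; apply: eq_bigr => y ys1 /=.
  have : y != h by apply: contraNneq hs1 => <-.
  by rewrite -(inj_eq enum_rank_inj) -val_eqE neq_ltn /=; case: ltngtP; rewrite ?addbF.
rewrite !invE inv12 !qB // q'E eqxx.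
have -> : \big[addb/false]_(y <- s | (enum_rank y < enum_rank h)%N) q y
  = \big[addb/false]_(y <- s1 | (enum_rank y < enum_rank h)%N) q y
    (+) \big[addb/false]_(y <- s2 | (enum_rank y < enum_rank h)%N) q y.
  by rewrite sE big_cat big_cons ltnn.
bool_taut.
Qed.

End Update.

(** * Coloring sums under linear maps and derivations *)

Section ColoringPush.
Variables (F : fieldType) (K : finType).
Local Open Scope ring_scope.

Lemma big_enumeration (s : seq K) (f : K -> F) : uniq s -> (forall h, h \in s) ->
  \prod_(h <- s) f h = \prod_h f h.
Proof.
move=> us sK; apply/perm_big/uniq_perm => //; first exact: index_enum_uniq.
by move=> h; rewrite sK mem_index_enum.
Qed.

Lemma push_coloring (L L' : finType) (M : L -> L' -> F) g (c' : K -> L') (s : seq K) :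
    uniq s -> (forall h, h \in s) ->
  push M g (map c' s) = \sum_(c : {ffun K -> L}) g (map c s) * \prod_h M (c h) (c' h).
Proof.
move=> us sK; rewrite push_zip.
rewrite (@sum_coloring _ _ _ s _ (fun u => g u * \prod_(p <- zip u (map c' s)) M p.1 p.2)) ?size_map //.
by apply: eq_bigr => c _; rewrite zip_map big_map (big_enumeration _ us sK).
Qed.

Variables (L L' : finType) (M : L -> L' -> F).
Variables (par : L -> bool) (par' : L' -> bool).
Variables (B : L -> L -> F) (B' : L' -> L' -> F).
Hypothesis M_par : forall a b, M a b != 0 -> par' b = par a.
Hypothesis BB' : forall a a', B a a' = \sum_b \sum_b' B' b b' * M a b * M a' b'.
Variable chl : seq K.
Hypotheses (chl_uniq : uniq chl) (chl_mem : forall h, h \in chl) (chl_even : ~~ odd (size chl)).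

Definition push_words (x : seq (seq L) -> F) (ws : seq (seq L')) : F :=
  push M (fun s => x (reshape (shape ws) s)) (flatten ws).

Lemma shape_map_map (T T' : Type) (c : T -> T') m : shape (map (map c) m) = shape m.
Proof. by rewrite /shape -map_comp; apply: eq_map => l; rewrite /= size_map. Qed.

Lemma reshape_map_flatten (T T' : Type) (c : T -> T') m :
  reshape (shape m) (map c (flatten m)) = map (map c) m.
Proof. by rewrite map_flatten -(shape_map_map c) flattenK. Qed.

(** Expanded over both kinds of colorings, the pushforward is the kernel [\prod_h M (c h) (c' h)].
    Where it is nonzero, [c] and [c'] have equal parities, hence equal signs; summing out [c'] then
    turns [B'] into [B]. *)
Lemma coloring_sum_push x m : uniq (flatten m) -> (forall h, h \in flatten m) ->
  coloring_sum par' B' chl (push_words x) m = coloring_sum par B chl x m.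
Proof.
move=> um mK; rewrite /coloring_sum.
have sgn (c : {ffun K -> L}) (c' : {ffun K -> L'}) s (z : F) :
    (-1) ^+ (inv_parity (par' \o c') chl (+) inv_parity (par' \o c') s) * (z * \prod_h M (c h) (c' h))
    = (-1) ^+ (inv_parity (par \o c) chl (+) inv_parity (par \o c) s) * (z * \prod_h M (c h) (c' h)).
  have [->|/prodf_neq0 nz] := eqVneq (\prod_h M (c h) (c' h)) 0; first by rewrite !mulr0.
  have qq' t : inv_parity (par' \o c') t = inv_parity (par \o c) t.
    by apply: eq_inv_parity => h _; apply: M_par; apply: nz.
  by rewrite !qq'.
transitivity (\sum_(c' : {ffun K -> L'}) \sum_(c : {ffun K -> L})
   (-1) ^+ (inv_parity (par \o c) chl (+) inv_parity (par \o c) (flatten m))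
     * x (map (map c) m) * (pairing_word B' (map c' chl) * \prod_h M (c h) (c' h))).
  apply: eq_bigr => c' _; rewrite /push_words shape_map_map -map_flatten push_coloring //.
  rewrite big_distrr; apply: eq_bigr => c _ /=.
  by rewrite -mulrA sgn reshape_map_flatten; ring.
rewrite exchange_big; apply: eq_bigr => c _ /=.
rewrite -big_distrr /= -(push_pairing BB') ?size_map // push_coloring //=.
by rewrite mulrC mulrA.
Qed.

Lemma eq_coloring_sum x y m :
  (forall ws : seq (seq L), shape ws = shape m -> x ws = y ws) ->
  coloring_sum par B chl x m = coloring_sum par B chl y m.
Proof. by move=> xy; apply: eq_bigr => c _; rewrite xy ?shape_map_map. Qed.

(* The involution (c, a) |-> (update c h a, c h) moves the derivation from f to *)
(* the pairing, which it annihilates.                                          *)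
Lemma coloring_sum_letter_der p (xi : L -> L -> F) f sh m :
    uniq (flatten m) -> (forall h, h \in flatten m) ->
    (forall a b, xi a b != 0 -> par b = par a (+) p) ->
    (forall a b, \sum_c xi a c * B c b + (-1) ^+ (p && par a) * \sum_c xi b c * B a c = 0) ->
  coloring_sum par B chl (fun ws => (shape ws == sh)%:R * letter_der par p xi f (flatten ws)) m = 0.
Proof.
move=> um mK xi_par xi_inv; set fl := flatten m.
pose bef (c : {ffun K -> L}) h s := wparity (par \o c) (take (index h s) s).
pose sg (c : {ffun K -> L}) := inv_parity (par \o c) chl (+) inv_parity (par \o c) fl.
pose T (c : {ffun K -> L}) h a : F := pairing_word B (map c chl) * (-1) ^+ sg c
   * ((-1) ^+ (p && bef c h fl) * xi a (c h) * f (map (update c h a) fl)).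
suff S0 : \sum_(c : {ffun K -> L}) \sum_h \sum_a T c h a = 0.
  rewrite -[RHS](mulr0 (shape m == sh)%:R) -S0 big_distrr; apply: eq_bigr => c _ /=.
  rewrite shape_map_map mulrCA -map_flatten letter_der_coloring //; congr (_ * _).
  have -> : \sum_h \sum_a T c h a = \sum_(h <- fl) \sum_a T c h a.
    apply/perm_big/uniq_perm => //; first exact: index_enum_uniq.
    by move=> h; rewrite mem_index_enum mK.
  by rewrite big_distrr; apply: eq_bigr => h _; rewrite big_distrr.
rewrite exchange_big /=.
pose U (c : {ffun K -> L}) h b : F := (-1) ^+ sg c * f (map c fl)
   * ((-1) ^+ (p && bef c h chl) * xi (c h) b * pairing_word B (map (update c h b) chl)).
transitivity (\sum_h \sum_(c : {ffun K -> L}) \sum_b U c h b).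
  apply: eq_bigr => h _; rewrite !pair_big /=.
  pose swap (cb : {ffun K -> L} * L) := (update cb.1 h cb.2, cb.1 h).
  have swapK : involutive swap.
    by case=> c b; rewrite /swap /= update_update updateE update_id.
  rewrite (reindex_inj (inv_inj swapK)); apply: eq_bigr => -[c b] _.
  rewrite /T /U /= updateE update_update update_id.
  have [->|/xi_par cb] := eqVneq (xi (c h) b) 0; first by rewrite !(mul0r, mulr0).
  have befE : bef (update c h b) h fl = bef c h fl.
    rewrite /bef /wparity; congr odd; apply: eq_in_count => k kt /=; rewrite ffunE.
    case: eqP kt => // ->; move: um; rewrite -/fl -{1}(cat_take_drop (index h fl) fl) cat_uniq.
    rewrite (drop_nth h) ?index_mem ?mK // nth_index ?mK //= negb_or.
    by case/and4P=> _ /andP[/negPf -> _].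
  have invE s : uniq s -> (forall h, h \in s) ->
      inv_parity (par \o update c h b) s = inv_parity (par \o c) s (+) (p && bef c h s)
       (+) (p && \big[addb/false]_(y | (enum_rank y < enum_rank h)%N) par (c y)).
    move=> us sK; apply/eqP; rewrite addbAC -(inv_parity_update us sK (q' := par \o update c h b)).
      by rewrite -addbA addbb addbF.
    by move=> k; rewrite /= ffunE; case: eqP => // ->.
  set e1 := (-1) ^+ sg (update c h b); set e2 := (-1) ^+ (p && bef (update c h b) h fl).
  set e3 := (-1) ^+ sg c; set e4 := (-1) ^+ (p && bef c h chl).
  (* The correction of [inv_parity_update] occurs once for [chl] and once for [fl] and cancels. The
     letters before [h] in [fl] cancel against [e2], so only those before [h] in [chl] remain. *)
  have e12 : e1 * e2 = e3 * e4 :> F.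
    rewrite /e1 /e2 /e3 /e4 -!signr_addb; congr (_ ^+ nat_of_bool _).
    rewrite befE /sg !invE //; move: (p && bef c h chl) (p && bef c h fl) => u v.
    by case: (inv_parity _ chl); case: (inv_parity _ fl); case: u; case: v; case: (p && _).
  clearbody e1 e2 e3 e4; move: (pairing_word _ _) (xi _ _) (f _) => z1 z2 z3.
  by transitivity (e1 * e2 * (z1 * z2 * z3)); [ring | rewrite e12; ring].
rewrite exchange_big big1 // => c _ /=.
under eq_bigr => h _ do rewrite -big_distrr /=.
rewrite -big_distrr /=.
have := letter_der_pairing xi_inv (t := map c chl); rewrite size_map => /(_ chl_even).
rewrite letter_der_coloring // => E.
rewrite (_ : \sum_h _ = 0) ?mulr0 // -[RHS]E.
apply/perm_big/uniq_perm => //; first exact: index_enum_uniq.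
by move=> h; rewrite mem_index_enum chl_mem.
Qed.

End ColoringPush.

(** * Alternating tensors *)

Section DecomposableTensors.
Variables (F : fieldType) (L : finType) (par : L -> bool).
Local Open Scope ring_scope.
Implicit Types (fs gs : seq (seq L -> F)) (ws : seq (seq L)) (x y : seq (seq L) -> F).

(** The decomposable tensor f_1 (x) ... (x) f_l as a function on lists of words. N acts on it factor
    by factor, which handles the relations, as these are written in basis tensors. *)
Fixpoint tens fs ws : F :=
  match fs, ws with
  | [::], [::] => 1
  | f :: fs', w :: ws' => f w * tens fs' ws'
  | _, _ => 0
  end.

Lemma word_tens (ss ws : seq (seq L)) : word F ss ws = tens (map (@word F _) ss) ws.
Proof.
elim: ss ws => [|s ss IH] [|w ws] //=; rewrite -IH /word eqseq_cons.
by rewrite -natrM mulnb.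
Qed.

Lemma tens_size fs ws : size fs != size ws -> tens fs ws = 0.
Proof.
elim: fs ws => [|f fs IH] [|w ws] //=; rewrite eqSS => /IH ->; exact: mulr0.
Qed.

Lemma tens_cat fs gs ws vs : size fs = size ws ->
  tens (fs ++ gs) (ws ++ vs) = tens fs ws * tens gs vs.
Proof.
elim: fs ws => [|f fs IH] [|w ws] //=; first by rewrite mul1r.
by case=> /IH ->; rewrite mulrA.
Qed.

Lemma tens_scale fs f g gs k ws : (forall u, f u = k * g u) ->
  tens (fs ++ f :: gs) ws = k * tens (fs ++ g :: gs) ws.
Proof.
move=> fg; elim: fs ws => [|f' fs IH] [|w ws] /=; rewrite ?mulr0 //.
  by rewrite fg mulrA.
by rewrite IH mulrCA.
Qed.

Lemma eq_Nsym_all x y ws : (forall vs, shape vs = shape ws -> x vs = y vs) ->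
  Nsym_all par x ws = Nsym_all par y ws.
Proof.
elim: ws x y => [|w ws IH] x y xy /=; first exact: xy.
apply: IH => vs vsE; apply: eq_Nsym => i _.
by apply: xy; rewrite /= size_rot vsE.
Qed.

Lemma Nsym_allZ k x ws : Nsym_all par (fun vs => k * x vs) ws = k * Nsym_all par x ws.
Proof.
elim: ws x => [|w ws IH] x //=; rewrite -IH; apply: eq_Nsym_all => vs _.
exact: NsymZ.
Qed.

Lemma Nsym_allD x y ws :
  Nsym_all par (fun vs => x vs + y vs) ws = Nsym_all par x ws + Nsym_all par y ws.
Proof.
elim: ws x y => [|w ws IH] x y //=; rewrite -IH; apply: eq_Nsym_all => vs _.
exact: NsymD.
Qed.

Lemma Nsym_all_tens fs ws : Nsym_all par (tens fs) ws = tens (map (Nsym par) fs) ws.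
Proof.
elim: ws fs => [|w ws IH] [|f fs] //=.
  rewrite (@eq_Nsym_all _ (fun vs => 0 * tens [::] vs)) ?Nsym_allZ ?mul0r // => vs _.
  by rewrite mul0r Nsym0.
rewrite -IH -Nsym_allZ; apply: eq_Nsym_all => vs _.
by rewrite mulrC -NsymZ; apply: eq_Nsym => i _; rewrite mulrC.
Qed.

Lemma Nsym_all_prod (h : seq L -> F) ws :
  Nsym_all par (fun vs => \prod_(s <- vs) h s) ws = \prod_(s <- ws) Nsym par h s.
Proof.
elim: ws => [|w ws IH] /=; first by rewrite !big_nil.
rewrite big_cons -IH -Nsym_allZ; apply: eq_Nsym_all => vs _.
by rewrite mulrC -NsymZ; apply: eq_Nsym => i _; rewrite big_cons mulrC.
Qed.

Lemma Nsym_word_neq0 s u : Nsym par (word F s) u != 0 -> wparity par u = wparity par s.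
Proof.
rewrite Nsym_rot => nz; apply/eqP; apply: contraNT nz => us.
rewrite big1 // => i _; rewrite /word; case: eqP => [E|]; last by rewrite mulr0.
by case/eqP: us; rewrite -E (wparity_perm _ (permEl (perm_rot _ _))).
Qed.

Lemma Nsym_all_cyc us s vs ws :
  Nsym_all par (fun ws => word F (us ++ s :: vs) ws
      - (-1) ^+ (wparity par (take 1 s) && wparity par (drop 1 s))
        * word F (us ++ rot 1 s :: vs) ws) ws = 0.
Proof.
set e := (-1) ^+ _.
rewrite (@eq_Nsym_all _ (fun ws => tens (map (@word F _) (us ++ s :: vs)) ws
   + - e * tens (map (@word F _) (us ++ rot 1 s :: vs)) ws)) => [|vs' _]; last first.
  by rewrite -!word_tens mulNr.
rewrite Nsym_allD Nsym_allZ !Nsym_all_tens !map_cat /= mulNr.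
rewrite (@tens_scale _ _ (Nsym par (word F (rot 1 s))) _ e) ?subrr // => u.
apply/eqP; rewrite -subr_eq0 -NsymZ -NsymB; apply/eqP.
by rewrite -[RHS](Nsym_commutator F par (take 1 s) (drop 1 s) u) cat_take_drop.
Qed.

Section Alternation.
Variables (K : finType) (c : K -> L) (n : nat) (t : n.-tuple (seq K)).
Hypothesis t_uniq : uniq (flatten t).

Lemma permute_tperm (s : 'S_n) (a b : 'I_n) : b = a.+1 :> nat ->
  exists p l1 l2 r,
    [/\ size p = a, permute s t = p ++ l1 :: l2 :: r :> seq (seq K)
      & permute (tperm a b * s)%g t = p ++ l2 :: l1 :: r :> seq (seq K)].
Proof.
move=> ba; set u := permute s t; have szu := size_tuple u.
have an : (a < n)%N := ltn_ord a; have bn : (b < n)%N := ltn_ord b.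
exists (take a u), (tnth u a), (tnth u b), (drop b.+1 u).
have uE : tval u = take a u ++ tnth u a :: tnth u b :: drop b.+1 u.
  rewrite -[LHS](cat_take_drop a); congr (_ ++ _).
  rewrite (drop_nth [::]) ?szu // -(tnth_nth [::] u a) -ba.
  by rewrite (drop_nth [::]) ?szu // -(tnth_nth [::] u b).
have sa : size (take a u) = a by rewrite size_takel // szu ltnW.
split=> //; apply: (@eq_from_nth _ [::]).
  by rewrite size_tuple !size_cat /= size_drop szu sa ba; lia.
move=> i; rewrite size_tuple => lti.
have nE (j : 'I_n) : nth [::] u j = tnth u j by rewrite (tnth_nth [::]).
rewrite (nth_mktuple _ _ (Ordinal lti)) permM.
have -> : tnth t (s (tperm a b (Ordinal lti))) = tnth u (tperm a b (Ordinal lti)).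
  by rewrite tnth_mktuple.
rewrite -nE nth_cat sa; case: tpermP => [/(congr1 val) /= ->|/(congr1 val) /= ->|na nb].
- by rewrite ltnn subnn /= nE.
- by rewrite ltnNge ba leqnSn /= subSnn /= -nE.
rewrite /=.
case: ltnP => [ia|ai]; first by rewrite nth_take.
have ia : i != a by apply: contra_notN na => /eqP E; apply: val_inj.
have ib : i != b by apply: contra_notN nb => /eqP E; apply: val_inj.
have lt_bi : (b < i)%N by rewrite ba ltn_neqAle -ba eq_sym ib ba ltn_neqAle eq_sym ia ai.
have -> : (i - a = (i - b.+1).+2)%N by rewrite ba in lt_bi *; lia.
by rewrite /= nth_drop subnKC.
Qed.

Lemma inv_parity_swap (q : K -> bool) p l1 l2 r : uniq (flatten (p ++ l1 :: l2 :: r)) ->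
  inv_parity q (flatten (p ++ l2 :: l1 :: r)) =
  inv_parity q (flatten (p ++ l1 :: l2 :: r)) (+) (wparity q l1 && wparity q l2).
Proof.
rewrite !flatten_cat /= => u; have u12 : uniq (l1 ++ l2).
  move: u; rewrite (cat_uniq (flatten p)); case/and3P=> _ _.
  by rewrite catA (cat_uniq (l1 ++ l2)); case/and3P.
have p12 : perm_eq (l1 ++ l2) (l2 ++ l1) by rewrite perm_catC.
apply: (@addbI (inv_parity q (flatten p ++ l1 ++ l2 ++ flatten r))).
rewrite addbA addbb addFb !(catA l1) !(catA l2) inv_parity_catr ?perm_cat2r //.
rewrite inv_parity_catl // !inv_parity_cat -(cross_parityC q u12).
bool_taut.
Qed.

(** Pair [s] with the permutation that also exchanges the blocks k and k+1. The exchange costs -1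
    from sgn and (-1)^e from Koszul wherever [x] is nonzero; the latter is absorbed by the sign in
    [y], and the two terms cancel. *)
Lemma antisym_alt (k : nat) (e : bool) (x x' y : seq (seq L) -> F) : (k.+1 < n)%N ->
    (forall p w1 w2 r, size p = k -> x' (p ++ w2 :: w1 :: r) = x (p ++ w1 :: w2 :: r)) ->
    (forall p w1 w2 r, size p = k -> x (p ++ w1 :: w2 :: r) != 0 ->
       wparity par w1 && wparity par w2 = e) ->
    (forall ws, y ws = x ws + (-1) ^+ e * x' ws) ->
  antisym par y (map (map c) t) = 0.
Proof.
move=> kn xx' xe yE; rewrite antisym_permute //.
pose a : 'I_n := Ordinal (ltnW kn); pose b := Ordinal kn.
under eq_bigr => s _ do rewrite yE !mulrDr.
rewrite big_split /= [X in _ + X](reindex_inj (mulgI (tperm a b))) /=.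
rewrite -big_split big1 // => s _ /=.
have [p [l1 [l2 [r [sp E E']]]]] := @permute_tperm s a b (erefl _).
have up : uniq (flatten (permute s t)).
  by rewrite (perm_uniq (perm_flatten (permute_perm s t))).
rewrite E in up; rewrite E' odd_permM odd_tperm signr_addb E (inv_parity_swap _ up) !map_cat /=.
have -> : a != b by rewrite -val_eqE /= neq_ltn ltnSn.
rewrite xx' ?size_map //=; set z := x _.
have [z0|/xe] := eqVneq z 0; first by rewrite z0 !mulr0 addr0.
rewrite !wparity_map size_map => /(_ sp) ->.
set i1 := inv_parity _ _; set i2 := inv_parity _ _.
rewrite [i1 (+) e (+) i2]addbAC [(-1) ^+ (_ (+) e)]signr_addb.
rewrite signrN mulNr -(mulrA _ ((-1) ^+ e)) (mulrA ((-1) ^+ e)) -!signr_addb addbb mul1r.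
by rewrite subrr.
Qed.

Lemma antisym_Nsym_all_alt us s s' vs :
  antisym par (Nsym_all par (fun ws => word F (us ++ s :: s' :: vs) ws
      + (-1) ^+ (wparity par s && wparity par s')
        * word F (us ++ s' :: s :: vs) ws)) (map (map c) t) = 0.
Proof.
set e := wparity par s && wparity par s'.
pose N (w : seq L) := Nsym par (word F w).
pose x := tens (map N us ++ N s :: N s' :: map N vs).
pose x' := tens (map N us ++ N s' :: N s :: map N vs).
have yE ws : Nsym_all par (fun ws => word F (us ++ s :: s' :: vs) ws
      + (-1) ^+ e * word F (us ++ s' :: s :: vs) ws) ws = x ws + (-1) ^+ e * x' ws.
  rewrite Nsym_allD Nsym_allZ; congr (_ + _ * _);
    by rewrite (@eq_Nsym_all _ _ _ (fun vs _ => word_tens _ vs)) Nsym_all_tens !map_cat /= -!map_comp.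
have [lt_n|ge_n] := ltnP (size us).+1 n.
  apply: (antisym_alt lt_n _ _ yE) => p w1 w2 r sp; rewrite /x /x' !tens_cat ?size_map //=.
    by rewrite [N s' w2 * _]mulrCA.
  rewrite !mulf_eq0 !negb_or => /and4P[_ n1 n2 _].
  by rewrite (Nsym_word_neq0 n1) (Nsym_word_neq0 n2).
(* Here the relation lies in an exterior power higher than [n], and both tensors vanish because of
   their length. *)
rewrite antisym_permute // big1 // => sg _; rewrite yE /x /x'.
have sz : size (map (map c) (permute sg t)) = n by rewrite size_map size_tuple.
rewrite !tens_size ?mulr0 ?addr0 ?mulr0 // sz size_cat /= !size_map neq_ltn;
  by apply/orP; right; rewrite (leq_ltn_trans ge_n) // !addnS !ltnS leq_addr.
Qed.

End Alternation.

End DecomposableTensors.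

(** * Invariance of the pairing *)

Section GraphEvaluation.
Variables (F : fieldType) (G : graph) (Gt : full_order G).
Local Open Scope ring_scope.
Local Notation H := (hedge G).

(* F_Gamma, for the graph represented by Gt. *)
Definition graph_eval (L : finType) (par : L -> bool) (B : L -> L -> F)
    (x : seq (seq L) -> F) : F :=
  contract par B Gt (antisym par (Nsym_all par x)).

Definition fo_tuple := [tuple of map (fo_hedges Gt) (fo_order Gt).1].

Lemma size_hedge : #|H| = (#|edges G|.*2)%N.
Proof.
rewrite -cardsT (card_uniform_partition (n := 2) _ (edges_partition G)) ?muln2 //.
by move=> e; apply: edges_card.
Qed.

Lemma chord_list_even : ~~ odd (size (chord_list Gt)).
Proof. by rewrite size_chord_list size_hedge odd_double. Qed.

Lemma permute_fo_perm (s : 'S_#|verts G|) : perm_eq (permute s fo_tuple) (fo_lists Gt).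
Proof. exact: (permute_perm s fo_tuple). Qed.

Lemma fo_lists_size l : l \in fo_lists Gt -> (2 < size l)%N.
Proof.
case/mapP => v vG ->; rewrite mem_fo_verts in vG.
have <- : #|v| = size (fo_hedges Gt v).
  by rewrite -(card_uniqP (fo_uniq Gt vG)); apply/esym/eq_card => h; rewrite fo_mem.
exact: verts_valency.
Qed.

Lemma in_bidegree_fo (T : Type) (ws : seq (seq T)) (s : 'S_#|verts G|) :
  shape ws = shape (permute s fo_tuple) -> in_bidegree #|verts G| #|edges G| ws.
Proof.
move=> wsE; have wsp : perm_eq (shape ws) (shape (fo_lists Gt)).
  by rewrite wsE perm_map // permute_fo_perm.
apply/and3P; split.
- by rewrite -(size_map size) -/(shape ws) (perm_size wsp) !size_map size_tuple.
- by rewrite (perm_sumn wsp) -size_flatten size_fo_lists size_hedge.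
have -> : all (fun w => 2 < size w)%N ws = all (fun k => 2 < k)%N (shape ws).
  by rewrite all_map.
rewrite (perm_all _ wsp) all_map; apply/allP => l; exact: fo_lists_size.
Qed.

Variables (L : finType) (par : L -> bool) (B : L -> L -> F).
Implicit Types x y : seq (seq L) -> F.

Lemma graph_eval_expand x :
  graph_eval par B x = \sum_(s : 'S_#|verts G|) (-1) ^+ s *
    \sum_(m <- rotations (permute s fo_tuple)) coloring_sum par B (chord_list Gt) x m.
Proof.
rewrite /graph_eval contract_coloring -(@coloring_sum_expand F H L par B _ _ _ fo_tuple) //.
exact: uniq_fo_lists.
Qed.

Lemma rotations_fo (s : 'S_#|verts G|) m : m \in rotations (permute s fo_tuple) ->
  [/\ uniq (flatten m), forall h, h \in flatten m & shape m = shape (permute s fo_tuple)].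
Proof.
move=> mr; have pm : perm_eq (flatten m) (flatten (fo_lists Gt)).
  exact: perm_trans (rotations_perm mr) (perm_flatten (permute_fo_perm s)).
split; first by rewrite (perm_uniq pm) uniq_fo_lists.
  by move=> h; rewrite (perm_mem pm) mem_fo_lists.
exact: rotations_shape.
Qed.

(** Every arrangement has one block per vertex, of at least three half-edges, and twice as many
    half-edges as edges in total; so only one bigraded component is seen. *)
Lemma eq_graph_eval x y :
    (forall ws, in_bidegree #|verts G| #|edges G| ws -> x ws = y ws) ->
  graph_eval par B x = graph_eval par B y.
Proof.
move=> xy; rewrite !graph_eval_expand; apply: eq_bigr => s _; congr (_ * _).
rewrite !big_seq; apply: eq_bigr => m /rotations_fo[_ _ mE].
by apply: eq_coloring_sum => ws wsE; apply/xy/(in_bidegree_fo (s := s)); rewrite wsE.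
Qed.

Lemma graph_evalD x y :
  graph_eval par B (fun ws => x ws + y ws) = graph_eval par B x + graph_eval par B y.
Proof.
rewrite !graph_eval_expand -big_split; apply: eq_bigr => s _ /=.
rewrite -mulrDr -big_split /=; congr (_ * _); apply: eq_bigr => m _ /=.
by rewrite -big_split; apply: eq_bigr => c _; rewrite mulrDr.
Qed.

Lemma graph_evalZ k x : graph_eval par B (fun ws => k * x ws) = k * graph_eval par B x.
Proof.
rewrite !graph_eval_expand big_distrr; apply: eq_bigr => s _ /=.
rewrite mulrCA; congr (_ * _); rewrite big_distrr; apply: eq_bigr => m _ /=.
by rewrite big_distrr; apply: eq_bigr => c _; rewrite mulrCA.
Qed.

Lemma graph_eval_span (R : (seq (seq L) -> F) -> Prop) x :
  (forall y, R y -> graph_eval par B y = 0) -> lin_span R x -> graph_eval par B x = 0.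
Proof.
have eqE y y' : y =1 y' -> graph_eval par B y = graph_eval par B y'.
  by move=> yy'; apply: eq_graph_eval => ws _.
move=> R0; elim=> {x} [x x0|k y x x' Ry _ IH x'E].
  by rewrite -[RHS](mul0r (graph_eval par B x)) -graph_evalZ; apply: eqE => ws; rewrite x0 mul0r.
by rewrite (eqE _ _ x'E) graph_evalD graph_evalZ IH R0 // mulr0 addr0.
Qed.

Lemma graph_eval_antisym0 x :
  (forall c : H -> L, antisym par (Nsym_all par x) (map (map c) fo_tuple) = 0) ->
  graph_eval par B x = 0.
Proof.
move=> x0; rewrite /graph_eval contract_coloring /coloring_sum big1 // => c _.
by rewrite (x0 c) mulr0.
Qed.

Lemma graph_eval_push (L' : finType) (M : L -> L' -> F) (par' : L' -> bool)
    (B' : L' -> L' -> F) x :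
    (forall a b, M a b != 0 -> par' b = par a) ->
    (forall a a', B a a' = \sum_b \sum_b' B' b b' * M a b * M a' b') ->
  graph_eval par' B' (push_words M x) = graph_eval par B x.
Proof.
move=> M_par BB'; rewrite /graph_eval !contract_coloring.
have u := uniq_fo_lists Gt.
rewrite -[fo_lists Gt]/(tval fo_tuple) !(@coloring_sum_expand F H _ _ _ _ _ _ fo_tuple) //.
apply: eq_bigr => s _; congr (_ * _); rewrite !big_seq; apply: eq_bigr => m.
case/rotations_fo => um mK _; apply: coloring_sum_push => //.
- exact: uniq_chord_list.
- exact: mem_chord_list.
- exact: chord_list_even.
Qed.

End GraphEvaluation.

(** * Relations and stabilization for the canonical form *)

Section CanonicalEvaluation.
Variables (F : fieldType) (G : graph) (Gt : full_order G).
Local Open Scope ring_scope.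

(** Cyclic relations die under N, exterior relations under antisymmetrization. The osp relations die
    arrangement by arrangement, by moving the derivation onto the invariant pairing. *)
Lemma graph_eval_chain_relation n m x : chain_relation x ->
  graph_eval Gt (@lpar n m) (@canon_form F n m) x = 0.
Proof.
case=> {x} [us s vs _|us s t vs _|p xi ss _ [xi_par xi_inv]].
- apply: graph_eval_antisym0 => c; rewrite /antisym big1 // => sg _.
  by rewrite /kact Nsym_all_cyc !mulr0.
- by apply: graph_eval_antisym0 => c; apply: antisym_Nsym_all_alt; apply: uniq_fo_lists.
rewrite graph_eval_expand big1 // => sg _.
rewrite big_seq big1 ?mulr0 // => m' /rotations_fo[um mK _].
rewrite -[RHS](@coloring_sum_letter_der F _ _ (@lpar n m) (@canon_form F n m)
  (chord_list Gt) (uniq_chord_list Gt) (mem_chord_list Gt) (chord_list_even Gt) p xi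
  (word F (flatten ss)) (shape ss) m') //.
by apply: eq_bigr => c _; rewrite (@der_letter _ _ _ p).
Qed.

Definition widen_letter n m n' m' (nn' : (n <= n')%N) (mm' : (m <= m')%N)
    (a : letter n m) : letter n' m' :=
  match a with
  | inl (inl i) => inl (inl (widen_ord nn' i))
  | inl (inr i) => inl (inr (widen_ord nn' i))
  | inr i => inr (widen_ord mm' i)
  end.

Lemma graph_eval_stabilize n m n' m' (x : seq (seq (letter n m)) -> F) :
    (n <= n')%N -> (m <= m')%N ->
  graph_eval Gt (@lpar n' m') (@canon_form F n' m') (stabilize x)
    = graph_eval Gt (@lpar n m) (@canon_form F n m) x.
Proof.
move=> nn' mm'; pose j := widen_letter nn' mm'.
have inclE a b : @letter_incl F n m n' m' a b = (b == j a)%:R.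
  case: a b => [[i|i]|i] [[k|k]|k] //=; rewrite ?(inj_eq inl_inj) ?(inj_eq inr_inj) //.
  - by rewrite eq_sym.
  - by rewrite eq_sym.
  by rewrite eq_sym.
have -> : stabilize x = push_words (@letter_incl F n m n' m') x by [].
apply: graph_eval_push => [a b|a a'].
  by rewrite inclE; case: (b =P j a) => [-> _|_]; [case: a => [[i|i]|i] | rewrite eqxx].
rewrite (bigD1 (j a)) //= (bigD1 (j a')) //= !inclE !eqxx !mulr1.
rewrite big1 => [|b /negPf ba]; last by rewrite inclE ba mulr0.
rewrite big1 => [|b /negPf ba]; last by rewrite big1 // => b' _; rewrite inclE ba mulr0 mul0r.
by rewrite !addr0; case: a a' => [[i|i]|i] [[k|k]|k].
Qed.

(** At a common level (N, M) of the direct limit the difference of the two chains, in the bidegree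
    of the graph, is a combination of relations; passing to that level changes no value. *)
Lemma graph_eval_cell_eq (c c' : cell F) :
  cell_eq #|verts G| #|edges G| c c' ->
  graph_eval Gt (@lpar _ _) (@canon_form F _ _) (@cell_chain _ c) =
  graph_eval Gt (@lpar _ _) (@canon_form F _ _) (@cell_chain _ c').
Proof.
case=> N [M [nN mM span]]; move: nN mM; rewrite !geq_max => /andP[n1 n2] /andP[m1 m2].
rewrite -(graph_eval_stabilize _ n1 m1) -(graph_eval_stabilize _ n2 m2).
have := graph_eval_span (@graph_eval_chain_relation N M) span.
rewrite (@eq_graph_eval _ _ _ _ _ _ _ (fun ws => stabilize (@cell_chain _ c) ws
    + -1 * stabilize (@cell_chain _ c') ws)) => [|ws ->]; last by rewrite mulN1r.
by rewrite graph_evalD graph_evalZ mulN1r => /eqP; rewrite subr_eq0 => /eqP.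
Qed.

End CanonicalEvaluation.

(** * The characteristic class *)

Section OddFactors.
Variable F : fieldType.
Local Open Scope ring_scope.

Lemma ksign_tperm01 n :
  ksign F xpredT (tperm (ord0 : 'I_n.+2) (lift ord0 ord0)) (ord_tuple n.+2) = -1.
Proof.
set o1 := lift _ _; rewrite ksign_big (bigD1 ord0) //= (big_pred1 o1) => [|b].
  rewrite big1 // => a a0; rewrite big1 // => b.
  have a_gt0 : (0 < a)%N by rewrite lt0n.
  case/andP=> ab; have b1 : (1 < b)%N by apply: leq_ltn_trans ab.
  rewrite [tperm _ _ b]tpermD -?val_eqE //=; last 2 first.
  - by rewrite neq_ltn (ltnW b1).
  - by rewrite neq_ltn b1.
  case: tpermP => [_|_ /=|_ _]; first by rewrite /= => /(ltn_trans b1).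
    by rewrite ltn0.
  by move=> /(ltn_trans ab); rewrite ltnn.
rewrite tpermL; case: tpermP => [->|->|/eqP b0 /eqP b1] //.
rewrite [RHS](negPf b1) /o1 /= /bump /=.
by case: (nat_of_ord b).
Qed.

(** With all letters odd, the coboundary formula makes the Koszul sign multiplicative, so it
    suffices to know it on transpositions. These are all conjugate to the exchange of 0 and 1, which
    inverts a single pair. *)
Lemma ksign_xpredT n (s : 'S_n) (T : Type) (v : n.-tuple T) :
  ksign F xpredT s v = (-1) ^+ s.
Proof.
pose e (s : 'S_n) := ksign F xpredT s (ord_tuple n).
have eE (s' : 'S_n) (T' : Type) (v' : n.-tuple T') : ksign F xpredT s' v' = e s'.
  exact: eq_ksign.
have eM (s1 s2 : 'S_n) : e (s1 * s2)%g = e s1 * e s2.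
  pose u := ord_tuple n; pose v2 := [tuple tnth u (s2 i) | i < n].
  pose v1 := [tuple tnth v2 (s1 i) | i < n].
  have uu : uniq u by rewrite enum_uniq.
  have v2E i : tnth v2 i = tnth u (s2 i) by rewrite tnth_mktuple.
  have v1E i : tnth v1 i = tnth v2 (s1 i) by rewrite tnth_mktuple.
  have v12E i : tnth v1 i = tnth u ((s1 * s2)%g i) by rewrite v1E v2E permM.
  have uv2 : uniq v2.
    by apply/tuple_uniqP => i j; rewrite !v2E !tnth_ord_tuple => /perm_inj.
  rewrite -(eE _ _ v1) -(eE s1 _ v1) -(eE s2 _ v2).
  rewrite (ksign_letter _ _ (@perm_inj _ _) v12E uu) (ksign_letter _ _ (@perm_inj _ _) v1E uv2).
  rewrite (ksign_letter _ _ (@perm_inj _ _) v2E uu) -signr_addb.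
  by congr (_ ^+ nat_of_bool _); bool_taut.
have e1 : e 1%g = 1.
  rewrite /e ksign_big big1 // => i _; rewrite big1 // => j.
  by rewrite !perm1; case: ltngtP.
have e2 (i j : 'I_n) : i != j -> e (tperm i j) = -1.
  move=> ij; have [n' nE] : exists n', n = n'.+2.
    case: (n) i j ij => [|[|n']] i j; first by case: i.
      by rewrite (ord1 i) (ord1 j).
    by exists n'.
  subst n; pose o1 : 'I_n'.+2 := lift ord0 ord0.
  (* The permutation [g] sends 0 to i and 1 to j, so it conjugates the exchange of 0 and 1 into that
     of i and j. *)
  pose g := (tperm ord0 i * tperm (tperm ord0 i o1) j)%g.
  have g0 : g ord0 = i.
    rewrite permM tpermL tpermD // 1?eq_sym //.
    by rewrite -{1}(tpermL ord0 i) (inj_eq perm_inj).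
  have g1 : g o1 = j by rewrite permM tpermL.
  have -> : tperm i j = (g^-1 * (tperm ord0 o1 * g))%g.
    by rewrite -g0 -g1 -tpermJ.
  clearbody g; rewrite !eM mulrCA -eM mulVg e1 mulr1.
  exact: ksign_tperm01.
case: (prod_tpermP s) => ts -> tsP; rewrite eE.
elim: ts tsP => [|[i j] ts IH] /=; first by rewrite big_nil odd_perm1 e1.
case/andP=> /= ij /IH {}IH; rewrite big_cons eM IH e2 // odd_permM odd_tperm ij.
by rewrite signrN mulN1r.
Qed.

Variables (L : finType) (par : L -> bool).

(** On odd factors the Koszul sign is sgn and cancels the sgn of the antisymmetrization, leaving n!
    equal terms. *)
Lemma antisym_prod_odd (g : seq L -> F) n (t : n.-tuple (seq L)) :
    (forall s, g s != 0 -> wparity par s) ->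
  antisym par (fun ws => \prod_(s <- ws) g s) t = n`!%:R * \prod_(s <- t) g s.
Proof.
move=> g_odd; rewrite antisym_tuple.
transitivity (\sum_(s in [set: 'S_n]) \prod_(s <- t) g s); last first.
  by rewrite sumr_const cardsT card_Sn mulr_natl.
apply: eq_big => [s|s _]; first by rewrite inE.
rewrite /kact; set v := [tuple _ | i < n].
have -> : \prod_(s <- v) g s = \prod_(s <- t) g s.
  by apply/perm_big/tuple_permP; exists s.
have [->|nz] := eqVneq (\prod_(s <- t) g s) 0; first by rewrite !mulr0.
rewrite (@eq_ksign _ _ _ _ xpredT _ _ _ v) ?ksign_xpredT => [|i].
  by rewrite mulrA -signr_addb addbb mul1r.
apply: g_odd; move: nz; rewrite prodf_seq_neq0 => /allP/(_ (tnth v i)) /=; apply.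
by rewrite tnth_mktuple mem_tnth.
Qed.

End OddFactors.

(** * The canonical form and the inverse of the inner product *)

Section CanonicalForm.
Variables (F : fieldType) (n m : nat).
Local Open Scope ring_scope.
Local Notation letter := (letter n m).
Local Notation canon_form := (@canon_form F n m).

Definition dual_letter (b : letter) : letter :=
  match b with
  | inl (inl i) => inl (inr i)
  | inl (inr i) => inl (inl i)
  | inr i => inr i
  end.

Definition letter_sign (b : letter) : bool := if b is inl (inr _) then true else false.

Lemma dual_letterK : involutive dual_letter.
Proof. by case=> [[i|i]|i]. Qed.

Lemma canon_formE b b' : canon_form b b' = (-1) ^+ letter_sign b * (b' == dual_letter b)%:R.
Proof.
case: b b' => [[i|i]|i] [[k|k]|k] //=;
  by rewrite ?(inj_eq inl_inj) ?(inj_eq inr_inj) ?mul1r ?mulN1r ?mulr0 ?oppr0 // eq_sym.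
Qed.

Lemma canon_form_orthogonal b b' :
  \sum_c canon_form c b * canon_form c b' = (b == b')%:R.
Proof.
rewrite (bigD1 (dual_letter b)) //= !canon_formE dual_letterK eqxx mulr1.
rewrite mulrA -signr_addb addbb mul1r big1 ?addr0 => [|c cb]; first by rewrite eq_sym.
rewrite !canon_formE; case: (b =P dual_letter c) => [E|_]; last by rewrite mulr0 mul0r.
by rewrite E dual_letterK eqxx in cb.
Qed.

(** N counts each dx_i dx_i twice, which is where the factor 1/2 in the canonical form is used up.
    The arguments of [canon_form] come out transposed. *)
Lemma Nsym_canon_omega b b' : (2%:R : F) != 0 ->
  Nsym (fpar (@lpar n m)) (@canon_omega F n m) [:: (b, true); (b', true)]
    = (-1) ^+ (~~ lpar b) * canon_form b' b.
Proof.
move=> two; have half : (2%:R^-1 + 2%:R^-1 : F) = 1.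
  by rewrite -[X in X + X]mul1r -mulrDl mulfV.
have wE (a a' d d' : letter) : word F [:: (a, true); (a', true)] [:: (d, true); (d', true)]
    = ((d == a) && (d' == a'))%:R.
  by rewrite /word !eqseq_cons !xpair_eqE !andbT.
have pq a a' : \sum_(l < n) ((a == p_ m l) && (a' == q_ m l))%:R
    = if a is inl (inl i) then (a' == q_ m i)%:R else 0 :> F.
  case: a => [[i|i]|i]; try by rewrite big1.
  rewrite (bigD1 i) //= eqxx big1 ?addr0 // => l li.
  by rewrite !(inj_eq inl_inj) eq_sym (negPf li).
have xx a a' : \sum_(l < m) ((a == x_ n l) && (a' == x_ n l))%:R
    = if a is inr i then (a' == x_ n i)%:R else 0 :> F.
  case: a => [[i|i]|i]; try by rewrite big1.
  rewrite (bigD1 i) //= eqxx big1 ?addr0 // => l li.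
  by rewrite (inj_eq inr_inj) eq_sym (negPf li).
have oE a a' : @canon_omega F n m [:: (a, true); (a', true)]
    = (if a is inl (inl i) then (a' == q_ m i)%:R else 0)
      + 2%:R^-1 * (if a is inr i then (a' == x_ n i)%:R else 0).
  rewrite -pq -xx /canon_omega; congr (_ + _ * _);
    by apply: eq_bigr => l _; rewrite wE.
rewrite Nsym_rot big_ord_recl big_ord1 /=.
rewrite /rot_sign /rot /wparity /= !addn0 !oddb /fpar /= mul1r !oE.
case: b b' => [[i|i]|i] [[k|k]|k] /=;
  rewrite ?(mulr0, addr0, add0r, expr0, expr1, mul1r, mulN1r, opprK) //
    ?(inj_eq inl_inj) ?(inj_eq inr_inj) ?subr0 ?oppr0 //.
  by rewrite eq_sym.
by rewrite [i == k]eq_sym -mulrDl half mul1r.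
Qed.

End CanonicalForm.

Section InverseForm.
Variables (F : fieldType) (A : sympAinf F) (n m : nat).
Variables (w : seq 'I_(dimU A) -> F) (phi : 'I_(dimU A) -> letter n m -> F).
Local Open Scope ring_scope.
Hypotheses (w_omega : order_zero_tensor w) (phi_symp : is_lin_symplectomorphism phi).
Hypothesis two_neq0 : (2%:R : F) != 0.
Local Notation par := (@ainf_par F A).

Lemma inner_product_symplectic b b' :
  \sum_a \sum_a' inner_product par w a a' * phi a b * phi a' b' = canon_form F b' b.
Proof.
case: phi_symp => phi_par _ om_canon.
pose Phi (k : 'I_(dimU A) * bool) (l : letter n m * bool) : F :=
  (k.2 == l.2)%:R * phi k.1 l.1.
have Phi_par k l : Phi k l != 0 -> fpar (@lpar n m) l = fpar par k.
  rewrite /Phi; case: (k.2 =P l.2) => [kl|_]; last by rewrite mul0r eqxx.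
  by rewrite mul1r => /phi_par; rewrite /fpar kl => ->.
have := DReq_Nsym [:: (b, true); (b', true)] om_canon.
rewrite Nsym_canon_omega // -(push_Nsym Phi_par) push2.
move/(congr1 ( *%R ((-1) ^+ (~~ lpar b)))).
rewrite [RHS]mulrA -signr_addb addbb mul1r => <-; rewrite big_distrr /=.
rewrite (eq_bigr (fun k : 'I_(dimU A) * bool => \sum_(k' : 'I_(dimU A) * bool)
   (if k.2 && k'.2 then inner_product par w k.1 k'.1 * phi k.1 b * phi k'.1 b' else 0))).
  rewrite -(pair_bigA _ (fun a c => \sum_(k' : 'I_(dimU A) * bool)
     (if c && k'.2 then inner_product par w a k'.1 * phi a b * phi k'.1 b' else 0))) /=.
  apply: eq_bigr => a _; rewrite big_bool /= [X in _ = _ + X]big1 ?addr0 //.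
  rewrite -(pair_bigA _ (fun a' c => (if c then inner_product par w a a' * phi a b * phi a' b' else 0))) /=.
  by apply: eq_bigr => a' _; rewrite big_bool /= addr0.
move=> [a c] _; rewrite big_distrr; apply: eq_bigr => -[a' c'] _ /=.
rewrite /Phi /=; case: c; case: c'; rewrite /= ?mul0r ?mulr0 ?mul0r ?mulr0 //.
rewrite !mul1r (Nsym_omega w_omega) Nsym_dd_form.
have [->|/phi_par ->] := eqVneq (phi a b) 0; first by rewrite !(mulr0, mul0r).
by rewrite !mulrA -signr_addb addbb mul1r.
Qed.

(** Let G and J be the matrices of the inner product and of the canonical form. Then phi^T G phi =
    J^T by [inner_product_symplectic], and J^T J = 1 by [canon_form_orthogonal], so the inverse of G
    is phi J phi^T. *)
Lemma inverse_formE a a' :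
  inverse_form w a a' = \sum_b \sum_b' canon_form F b b' * phi a b * phi a' b'.
Proof.
case: phi_symp => _ [psi [phi_psi psi_phi]] _.
set Gm := \matrix_(i, j) inner_product par w i j.
pose X : 'M[F]_(dimU A) := \matrix_(i, j) \sum_b \sum_b' canon_form F b b' * phi i b * phi j b'.
(* In matrices: G phi = psi^T J^T, obtained by cancelling phi^T on the left. *)
have gphi a0 b' : \sum_a1 inner_product par w a0 a1 * phi a1 b' = \sum_b psi b a0 * canon_form F b' b.
  under [RHS]eq_bigr => b _ do rewrite -inner_product_symplectic big_distrr /=.
  rewrite exchange_big /=.
  transitivity (\sum_a (a == a0)%:R * \sum_a1 inner_product par w a a1 * phi a1 b').
    rewrite [RHS](bigD1 a0) //= eqxx mul1r [X in _ = _ + X]big1 ?addr0 // => a1 /negPf ->.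
    exact: mul0r.
  apply: eq_bigr => a1 _; rewrite -phi_psi big_distrl; apply: eq_bigr => b _ /=.
  rewrite !big_distrr; apply: eq_bigr => a2 _ /=; ring.
have GX : Gm *m X = 1%:M.
  apply/matrixP => i j; rewrite !mxE.
  transitivity (\sum_b \sum_b' canon_form F b b' * phi j b' *
      \sum_a1 inner_product par w i a1 * phi a1 b).
    under eq_bigr => a1 _ do rewrite !mxE big_distrr /=.
    rewrite exchange_big; apply: eq_bigr => b _ /=.
    under eq_bigr => a1 _ do rewrite big_distrr /=.
    rewrite exchange_big; apply: eq_bigr => b' _ /=.
    by rewrite big_distrr; apply: eq_bigr => a1 _ /=; ring.
  transitivity (\sum_b' \sum_b2 phi j b' * psi b2 i
      * \sum_b canon_form F b b' * canon_form F b b2).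
    rewrite exchange_big; apply: eq_bigr => b' _ /=.
    under eq_bigr => b _ do rewrite gphi big_distrr /=.
    rewrite exchange_big; apply: eq_bigr => b2 _ /=.
    by rewrite big_distrr; apply: eq_bigr => b _ /=; ring.
  rewrite -[(i == j)]eq_sym -phi_psi; apply: eq_bigr => b' _.
  rewrite (bigD1 b') //= canon_form_orthogonal eqxx mulr1 big1 ?addr0 // => b2 b2b.
  by rewrite canon_form_orthogonal eq_sym (negPf b2b) mulr0.
have [Gu _] := mulmx1_unit GX.
have -> : inverse_form w a a' = X a a'.
  rewrite /inverse_form -/Gm; congr (fun_of_matrix _ a a').
  by rewrite -[X]mul1mx -(mulVmx Gu) -mulmxA GX mulmx1.
by rewrite mxE.
Qed.

End InverseForm.

(** * Evaluating graphs on the exponential of the Hamiltonian *)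

Section PartitionFunctionIsPairing.
Variables (F : fieldType) (A : sympAinf F) (n m : nat).
Variables (w : seq 'I_(dimU A) -> F) (phi : 'I_(dimU A) -> letter n m -> F).
Local Open Scope ring_scope.
Hypotheses (w_omega : order_zero_tensor w) (phi_symp : is_lin_symplectomorphism phi).
Hypothesis om_even : even_form (@ainf_par _ A) (@omega _ A).
Hypothesis F0 : forall k, (k.+1%:R : F) != 0.
Variable h : seq 'I_(dimU A) -> F.
Hypothesis h_hamiltonian : hamiltonian h.
Local Notation par := (@ainf_par F A).

Lemma push_htensor_odd s : push phi (htensor w) s != 0 -> wparity (@lpar n m) s.
Proof.
case: phi_symp => phi_par _ _; apply: contraR => s_even; apply/eqP.
rewrite (push_wparity phi_par) (negPf s_even) -[RHS](mul0r (push phi (htensor w) s)) -pushZ.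
apply: eq_push => u _; rewrite mul0r; case: ifP => // /eqP ue.
by apply/eqP; apply: contraFT ue => /(htensor_odd w_omega om_even) ->.
Qed.

(** As phi preserves parity, N h' is the image under phi of N h, that is, of the sum of the h_k.
    These factors are odd, so antisymmetrization gives l! and cancels 1/l!. Naturality then brings
    the contraction back to the inverse form of A. *)
Lemma graph_eval_char_class (G : graph) (Gt : full_order G) :
  graph_eval Gt (@lpar n m) (@canon_form F n m) (@cell_chain _ (char_class phi h #|verts G| #|edges G|))
    = contract par (inverse_form w) Gt (fun ws => \prod_(s <- ws) htensor w s).
Proof.
case: (phi_symp) => phi_par _ _; set l := #|verts G|.
(* In the bidegree of the graph the guard in [char_class] holds and [size ws] is [l], so only the
   l-th term of the exponential is involved. *)
rewrite (@eq_graph_eval _ _ _ _ _ _ _ (fun ws => (l`!)%:R^-1 * \prod_(s <- ws) push phi h s)); last first.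
  by move=> ws /and3P[/eqP wl _ wa] /=; rewrite wa wl.
rewrite graph_evalZ /graph_eval !contract_coloring.
have -> : coloring_sum (@lpar n m) (@canon_form F n m) (chord_list Gt)
    (antisym (@lpar n m) (Nsym_all (@lpar n m) (fun ws => \prod_(s <- ws) push phi h s))) (fo_lists Gt)
  = (l`!)%:R * coloring_sum (@lpar n m) (@canon_form F n m) (chord_list Gt)
    (fun ws => \prod_(s <- ws) push phi (htensor w) s) (fo_lists Gt).
  rewrite big_distrr; apply: eq_bigr => c _ /=; rewrite mulrCA; congr (_ * _).
  rewrite -(antisym_prod_odd [tuple of map (map c) (fo_tuple Gt)] push_htensor_odd).
  apply: eq_bigr => s _; rewrite /kact; congr (_ * (_ * _)).
  rewrite Nsym_all_prod; apply: eq_bigr => u _; rewrite -(push_Nsym phi_par).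
  by apply: eq_push => v _; apply: Nsym_hamiltonian.
have l0 : (l`!%:R : F) != 0 by rewrite -(prednK (fact_gt0 l)).
rewrite mulKf //.
rewrite -(coloring_sum_push phi_par (inverse_formE w_omega phi_symp (F0 1)) (uniq_chord_list Gt)
  (mem_chord_list Gt) (chord_list_even Gt) _ (uniq_fo_lists Gt) (mem_fo_lists Gt)).
by apply: eq_bigr => c _; rewrite prod_push.
Qed.

Lemma Z_graph_pairing x (Ga : ribbon_graph) : chain_eq x (char_class phi h) ->
  Z_graph w Ga = pairing_graph x Ga.
Proof.
move=> xE; rewrite /Z_graph /pairing_graph; congr (_ / _).
rewrite -graph_eval_char_class; apply/esym.
exact: (graph_eval_cell_eq (rg_full Ga) (xE _ _)).
Qed.

End PartitionFunctionIsPairing.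

Theorem theorem6p11 (R : realType) (A : sympAinf R[i])
  (Hmin : minimal A)
  (Heven : even_form (@ainf_par _ A) (@omega _ A))
  (Hord : order_zero (@ainf_par _ A) (@omega _ A))
  (w : seq 'I_(dimU A) -> R[i]) (Hw : order_zero_tensor w)
  (h : seq 'I_(dimU A) -> R[i]) (Hh : hamiltonian h)
  (n m : nat) (phi : 'I_(dimU A) -> letter n m -> R[i])
  (Hphi : is_lin_symplectomorphism phi)
  (x : chain R[i]) (Hx : chain_eq x (char_class phi h))
  (ga : graph_chain R[i]) :
  Z w ga = pairing x ga.
Proof.
apply: eq_bigr => -[c Ga] _ /=.
rewrite (Z_graph_pairing Hw Hphi Heven _ Hh _ Hx) // => k.
by rewrite Num.Theory.pnatr_eq0.
Qed.
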